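(* For all integers $n\ge 1$ and $0 \leq m \leq n-1$, the space $\mathrm{Gr}^{\mathrm{var}\leq m}_{1,n}$, with its regular CW structure given by the cells $U_\omega$, collapses onto (a subcomplex homeomorphic to) $\mathbb{RP}^m$; in particular $\mathrm{Gr}^{\mathrm{var}\leq m}_{1,n}$ is (simple) homotopy equivalent to $\mathbb{RP}^m$.
   Context: For $v\in\mathbb{R}^n$, $\mathrm{sgn}(v)\in\{-,0,+\}^n$ is the vector of signs of its entries, considered up to global negation. The sign variation $\mathrm{var}(v)$ is the number of sign changes in the entries of $v$ after deleting zeros. $\mathrm{Gr}^{\mathrm{var}\leq m}_{1,n}=\{v\in\mathbb{RP}^{n-1}:\mathrm{var}(v)\le m\}$, a regular CW complex whose open cells are $U_\omega=\{v\in\mathbb{RP}^{n-1}:\mathrm{sgn}(v)=\omega\}$ for nonzero sign vectors $\omega$ with $\mathrm{var}(\omega)\le m$. Collapsing ($\searrow$) means reduction by a sequence of elementary collapses (removing a free face together with the unique cell containing it), which is a simple homotopy equivalence. *)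

(* Defs.v *)
From HB Require Import structures.
From mathcomp Require Import all_boot all_order all_algebra generic_quotient.
From mathcomp Require Import all_classical all_reals all_analysis.
From Stdlib Require Relation_Operators.

Set Implicit Arguments.
Unset Strict Implicit.
Unset Printing Implicit Defensive.

Import Order.TTheory GRing.Theory Num.Theory.
Import numFieldNormedType.Exports.

Local Open Scope classical_set_scope.
Local Open Scope ring_scope.
Local Open Scope quotient_scope.

(* A subset [A] of a space is turned into a space by [set_type A], which carries
   the subspace topology. *)

Definition homeomorphic (X Y : topologicalType) : Prop :=
  exists (f : X -> Y) (g : Y -> X),
    [/\ continuous f, continuous g, cancel f g & cancel g f].

Definition homotopic (R : realType) (X Y : topologicalType) (f g : X -> Y) :
    Prop :=
  exists H : X * R -> Y,
    [/\ {within [set p : X * R | 0 <= p.2 <= 1], continuous H},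
        forall x, H (x, 0) = f x
      & forall x, H (x, 1) = g x].

Definition homotopy_equivalent (R : realType) (X Y : topologicalType) : Prop :=
  exists (f : X -> Y) (g : Y -> X),
    [/\ continuous f, continuous g, homotopic R (g \o f) id
      & homotopic R (f \o g) id].

Section cell_complexes.
Variable X : topologicalType.
Implicit Types (K L : set (set X)) (e t s : set X).

(* A finite cell complex in [X] is given by the set of its open cells. *)
Definition realization K : set X := \bigcup_(e in K) e.

Definition face t s : Prop := t `<=` closure s.

Definition subcomplex L K : Prop :=
  L `<=` K /\ forall e, L e -> closure e `<=` realization L.

(* [t] is a free face of [s] in [K]: the only cell of [K] other than [t] having
   [t] as a face is [s]. In a regular complex, [t] then has codimension 1 in [s]
   and [s] is maximal. *)
Definition free_face K t s : Prop :=
  [/\ K t, K s, t <> s, face t s &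
      forall e, K e -> face t e -> e = t \/ e = s].

Definition elementary_collapse K L : Prop :=
  exists t s, free_face K t s /\ L = K `\` [set t; s].

Definition collapses : set (set X) -> set (set X) -> Prop :=
  Relation_Operators.clos_refl_trans _ elementary_collapse.

End cell_complexes.

Section regular_CW.
Variable R : realType.

Definition sqnorm d (x : 'rV[R]_d) : R := \sum_i x 0 i ^+ 2.

Definition closed_disk d : set 'rV[R]_d := [set x | sqnorm x <= 1].
Definition open_disk d : set 'rV[R]_d := [set x | sqnorm x < 1].
Definition unit_sphere d : set 'rV[R]_d := [set x | sqnorm x = 1].
Arguments closed_disk : clear implicits.
Arguments open_disk : clear implicits.
Arguments unit_sphere : clear implicits.

(* In a Hausdorff space such a [phi] is a homeomorphism of the closed disk onto
   its image, which is the closure of [e]. *)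
Definition regular_characteristic_map (X : topologicalType) d (e : set X)
    (phi : 'rV[R]_d -> X) : Prop :=
  [/\ {within closed_disk d, continuous phi},
      {in closed_disk d &, injective phi}
    & phi @` open_disk d = e].

Definition regular_CW (X : topologicalType) (K : set (set X)) : Prop :=
  [/\ hausdorff_space X, finite_set K, trivIset K id &
      exists dim : set X -> nat, forall e, K e ->
        exists2 phi : 'rV[R]_(dim e) -> X, regular_characteristic_map e phi &
          forall x, unit_sphere (dim e) x ->
            exists2 e', K e' /\ (dim e' < dim e)%N & e' (phi x)].

Definition regular_CW_structure (X : topologicalType) (A : set X)
    (K : set (set X)) : Prop :=
  regular_CW K /\ realization K = A.

Definition cell_image (X Y : topologicalType) (A : set X) (B : set Y)
    (f : set_type A -> set_type B) (e : set X) : set Y :=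
  [set set_val (f x) | x in [set x : set_type A | e (set_val x)]].

Definition cellular_isomorphism (X Y : topologicalType) (K : set (set X))
    (L : set (set Y)) : Prop :=
  exists (f : set_type (realization K) -> set_type (realization L))
         (g : set_type (realization L) -> set_type (realization K)),
    [/\ continuous f, continuous g, cancel f g, cancel g f
      & cell_image f @` K = L].

Record cell_complex := CellComplex {
  cc_space : topologicalType;
  cc_cells : set (set cc_space) }.

Inductive deformation_step : cell_complex -> cell_complex -> Prop :=
| step_collapse (X : topologicalType) (K L : set (set X)) :
    regular_CW K -> elementary_collapse K L ->
    deformation_step (CellComplex K) (CellComplex L)
| step_isomorphism (X Y : topologicalType) (K : set (set X))
    (L : set (set Y)) :
    regular_CW K -> regular_CW L -> cellular_isomorphism K L ->
    deformation_step (CellComplex K) (CellComplex L).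

(* Formal deformation: a finite sequence of elementary collapses, elementary
   expansions and cellular isomorphisms through finite regular CW complexes. *)
Definition simple_homotopy_equivalent (X Y : topologicalType)
    (K : set (set X)) (L : set (set Y)) : Prop :=
  [/\ regular_CW K, regular_CW L &
      Relation_Operators.clos_refl_sym_trans _ deformation_step
        (CellComplex K) (CellComplex L)].

End regular_CW.

Section projective_space.
Variable R : realType.

Definition nonzero_vector n : topologicalType :=
  set_type [set v : 'rV[R]_n | v != 0].

Definition proportional n (v w : nonzero_vector n) : bool :=
  `[< exists2 c : R, c != 0 & set_val w = c *: set_val v >].

Lemma proportional_equiv n : equiv_class_of (@proportional n).
Proof.
split.
- by move=> v; apply/asboolP; exists 1; rewrite ?oner_neq0 ?scale1r.
- suff sym v w : @proportional n v w -> proportional w v.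
    by move=> v w; apply/idP/idP; exact: sym.
  move=> /asboolP[c c0 vw]; apply/asboolP; exists c^-1; first by rewrite invr_eq0.
  by rewrite vw scalerA mulVf// scale1r.
- move=> v u w /asboolP[c c0 uv] /asboolP[d d0 vw]; apply/asboolP.
  by exists (d * c); [rewrite mulf_neq0 | rewrite vw uv scalerA].
Qed.

Canonical proportional_equiv_rel n :=
  EquivRelPack (@proportional_equiv n).

(* The projectivization of R^n, i.e. RP^(n-1), with the quotient topology. *)
Definition projectivization n : topologicalType :=
  quotient_topology {eq_quot (@proportional_equiv_rel n)}.

Definition RP m : topologicalType := projectivization m.+1.

Definition line n (v : nonzero_vector n) : projectivization n :=
  \pi_(projectivization n) v.

End projective_space.

Section sign_variation.

Definition sgn (F : realDomainType) n (v : 'rV[F]_n) : 'rV[int]_n :=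
  map_mx (@sgz F) v.

Definition sign_vector n : set 'rV[int]_n :=
  [set w | forall i, w 0 i \in [:: -1; 0; 1]].

Definition var (F : realDomainType) n (v : 'rV[F]_n) : nat :=
  let s := [seq x <- [seq v 0 i | i <- enum 'I_n] | x != 0] in
  count (fun p => p.1 * p.2 < 0) (zip s (behead s)).

Variable R : realType.

(* [U w = U (- w)], since every line is spanned by both [v] and [- v]; taking
   the set of all [U w] therefore identifies [w] with [- w]. *)
Definition U n (w : 'rV[int]_n) : set (projectivization R n) :=
  [set line v | v in [set v : nonzero_vector R n | sgn (set_val v) = w]].

(* The subspace Gr^(var <= m)_(1,n) of RP^(n-1). *)
Definition Gr_var n m : set (projectivization R n) :=
  [set line v | v in [set v : nonzero_vector R n | (var (set_val v) <= m)%N]].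

Definition Gr_var_cells n m : set (set (projectivization R n)) :=
  [set U w | w in
    [set w : 'rV[int]_n | [/\ sign_vector w, w != 0 & (var w <= m)%N]]].

Definition RP_cells m : set (set (RP R m)) :=
  [set U w | w in [set w : 'rV[int]_m.+1 | sign_vector w /\ w != 0]].

End sign_variation.

Arguments Gr_var : clear implicits.
Arguments Gr_var_cells : clear implicits.
Arguments RP_cells : clear implicits.

(* Main.v *)
Require Import Defs.
From HB Require Import structures.
From mathcomp Require Import all_boot all_order all_algebra.
From mathcomp Require Import all_classical all_reals all_analysis.
From mathcomp Require Import zify lra ring.

Set Implicit Arguments.
Unset Strict Implicit.
Unset Printing Implicit Defensive.

Import Order.TTheory GRing.Theory Num.Theory.
Import numFieldNormedType.Exports.

Local Open Scope classical_set_scope.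
Local Open Scope ring_scope.

(** Every cell [U w] is an open simplex whose closure consists of the [U t] with
    [t] obtained from [w] or [- w] by setting entries to zero. Let [N] be the last
    nonzero position of [w], counted from [0], and suppose [m < N]. Since [w] has
    at most [m] sign changes, it does not alternate on all of [0 .. N]; let [i] be
    the largest position such that [w_i] and [w_(i+1)] do not have opposite signs.
    Switching [w_i] between [0] and [w_(i+1)] does not change the variation and
    matches the cells with [m < N] in pairs. Removing the pairs with [N]
    decreasing, then [i] increasing, then the dimension decreasing, is a sequence
    of elementary collapses onto the cells supported on the first [m+1]
    coordinates, which form a copy of RP^m.

    The homotopy equivalence is given by a linear flow. The shear
    [v_i |-> v_i + t v_(i+1)], [t >= 0], does not increase the variation, and for
    [t = 1] each leading zero that it creates costs a sign change. Hence if
    [var v <= m] and [v != 0], then after enough shears with [t = 1] one of the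
    first [m+1] coordinates is nonzero. Scaling the other coordinates by [1 - t]
    gives a deformation of Gr into the copy of RP^m. *)

(** * Sign variation of sequences *)

Section seq_variation.
Variable F : realDomainType.
Implicit Types (a b x y : F) (s r : seq F).

(* Number of sign changes of [a :: s] when [a != 0], and of [s] when [a = 0]. *)
Fixpoint seq_var a s : nat :=
  if s is x :: s' then
    if x == 0 then seq_var a s' else ((a * x < 0)%R + seq_var x s')%N
  else 0%N.

Definition entries n (v : 'rV[F]_n) : seq F := [seq v 0 i | i <- enum 'I_n].

Lemma seq_var_count a s (t := [seq x <- s | x != 0]) :
  seq_var a s = count (fun p => p.1 * p.2 < 0) (zip (a :: t) t).
Proof.
rewrite {}/t; elim: s a => //= x s IH a.
by case: eqP => //= _; rewrite IH.
Qed.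

(** The initial value [0] contributes no sign change, so [var] inherits the recursion of [seq_var],
    on which the inductions below run. *)
Lemma varE n (v : 'rV[F]_n) : var v = seq_var 0 (entries v).
Proof.
rewrite seq_var_count /var -/(entries v).
by case: [seq x <- entries v | x != 0] => //= x s; rewrite mul0r ltxx.
Qed.

Lemma mulr_lt0_sgz (G : realDomainType) (a b : G) :
  (a * b < 0) = (sgz a * sgz b < 0).
Proof. by rewrite -sgzM sgz_lt0. Qed.

(** If [a] and the next nonzero entry [y] have opposite signs, then the nonzero [x] has sign
    opposite to one of them. *)
Lemma seq_var_triangle a x s : x != 0 ->
  (seq_var a s <= (a * x < 0)%R + seq_var x s)%N.
Proof.
elim: s a x => //= y s IH a x x0.
case: eqP => [_|/eqP y0]; first exact: IH.
rewrite addnA leq_add2r.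
have [ay|//] := boolP (a * y < 0).
have [//|ax] := boolP (a * x < 0).
have [//|xy] := boolP (x * y < 0).
exfalso; move: ay ax xy x0 y0; rewrite (mulr_lt0_sgz a y) (mulr_lt0_sgz a x).
rewrite (mulr_lt0_sgz x y) -(sgz_eq0 x) -(sgz_eq0 y).
by case: (sgzP a); case: (sgzP x); case: (sgzP y).
Qed.

Lemma seq_var_cons a x s : (seq_var a s <= seq_var a (x :: s))%N.
Proof. by rewrite /=; case: eqP => // /eqP; exact: seq_var_triangle. Qed.

(** The copy makes no sign change with its original, so the effect is that of deleting position [i],
    and a deletion cannot increase the variation. *)
Lemma seq_var_replicate a s s' i : size s' = size s -> (i.+1 < size s)%N ->
  (forall j, j != i -> nth 0 s' j = nth 0 s j) ->
  nth 0 s' i = nth 0 s i.+1 -> (seq_var a s' <= seq_var a s)%N.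
Proof.
elim: i s s' a => [|i IH] [|x s] [|x' s'] a //= [ss] si eqs eqi.
  have -> : s' = s.
    by apply: (@eq_from_nth _ 0) => // j _; exact: (eqs j.+1).
  case: s {ss eqs} si eqi => //= y s _ ->.
  case: (eqVneq y 0) => y0.
    by case: eqP => // /eqP; exact: seq_var_triangle.
  have -> : (y * y < 0) = false by rewrite ltNge -expr2 sqr_ge0.
  have := seq_var_cons a x (y :: s).
  by rewrite /= (negbTE y0) add0n.
have ex : x' = x by exact: (eqs 0%N).
have H b : (seq_var b s' <= seq_var b s)%N.
  by apply: IH => // j ji; apply: (eqs j.+1).
by rewrite ex; case: eqP => // _; rewrite leq_add2l.
Qed.

Lemma seq_var_alternating a s N : (N < size s)%N ->
  (forall j, (j < N)%N -> nth 0 s j * nth 0 s j.+1 < 0) -> (N <= seq_var a s)%N.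
Proof.
elim: N s a => // N IH [|x [|y s]] a //= sN alt.
have xy : x * y < 0 by exact: (alt 0%N).
have x0 : x != 0 by apply: contraTneq xy => ->; rewrite mul0r ltxx.
have y0 : y != 0 by apply: contraTneq xy => ->; rewrite mulr0 ltxx.
have := IH (y :: s) 0 sN (fun j jN => alt j.+1 jN).
rewrite /= (negbTE x0) (negbTE y0) xy mul0r ltxx add0n add1n => Nk.
by apply: leq_trans (leq_addl _ _); rewrite ltnS.
Qed.

(** * Shears of sequences and their leading zeros *)

Fixpoint shear_seq (t : F) s : seq F :=
  if s is x :: s' then (x + t * head 0 s') :: shear_seq t s' else [::].

Lemma seq_var_sgz a b s : sgz a = sgz b -> seq_var a s = seq_var b s.
Proof.
move=> ab; elim: s => //= x s IH.
by rewrite (mulr_lt0_sgz a x) (mulr_lt0_sgz b x) ab IH.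
Qed.

Lemma sgz_addM t x y : 0 <= t -> x + t * y != 0 ->
  sgz (x + t * y) = sgz x \/ sgz (x + t * y) = sgz y.
Proof.
rewrite le_eqVlt => /orP[/eqP <-|t0 xy0]; first by rewrite mul0r addr0; left.
have ty : sgz (t * y) = sgz y by rewrite sgzM (gtr0_sgz t0) mul1r.
move: ty; case: (sgzP x) => x0; case: (sgzP y) => y0;
  case: (sgzP (x + t * y)) => xy; case: (sgzP (t * y)) => ty0 // _;
  try (by left); try (by right).
all: exfalso; first [lra | by move: xy0; rewrite xy eqxx].
Qed.

(** A nonzero [x + t * y] has the sign of [x] or of [y]. Up to zeros, the signs of the sheared
    sequence therefore form a subsequence, with repetitions, of those of [s]. *)
Lemma seq_var_shear t a s : 0 <= t ->
  (seq_var a (shear_seq t s) <= seq_var a s)%N.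
Proof.
move=> t0; elim: s a => //= x s IH a.
have cs := seq_var_cons a x s.
case: s IH cs => [|y s] IH cs; first by rewrite /= mulr0 addr0.
rewrite [head _ _]/=.
have [_|xy0] := eqVneq (x + t * y) 0; first exact: leq_trans (IH a) cs.
have [xs|xs] := eqVneq (sgz (x + t * y)) (sgz x).
  rewrite (seq_var_sgz _ xs) mulr_lt0_sgz xs -mulr_lt0_sgz.
  by rewrite -(sgz_eq0 x) -xs sgz_eq0 (negbTE xy0) leq_add2l.
have ys : sgz (x + t * y) = sgz y.
  by case: (sgz_addM t0 xy0) xs => [->|//]; rewrite eqxx.
have y0 : y != 0 by rewrite -(sgz_eq0 y) -ys sgz_eq0.
apply: leq_trans (leq_trans (leq_add (leqnn _) (IH _)) _) cs.
rewrite (seq_var_sgz _ ys) mulr_lt0_sgz ys -mulr_lt0_sgz /= (negbTE y0).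
have -> : (y * y < 0) = false by rewrite ltNge -expr2 sqr_ge0.
by [].
Qed.

Definition leading_zeros s : nat := find (fun x => x != 0) s.

(** The last of the leading zeros receives the first nonzero entry, while the earlier ones remain
    zero. *)
Lemma leading_zeros_shear s k : leading_zeros s = k.+1 ->
  has (fun x => x != 0) s -> leading_zeros (shear_seq 1 s) = k.
Proof.
elim: s k => //= x s IH k.
rewrite /leading_zeros /= -/(leading_zeros _) -/(leading_zeros _).
case: eqP => //= -> [sk] hs.
case: s IH sk hs => //= y s IH sk hs; rewrite mul1r add0r.
case: k sk => [|k] sk.
  by move: sk; rewrite /leading_zeros /=; case: (y =P 0).
have -> : y != 0 = false.
  by move: sk; rewrite /leading_zeros /=; case: (y =P 0).
by rewrite (IH k).
Qed.

(* Every leading zero created by the shear costs one sign change. *)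
Lemma leading_zeros_var_shear s : leading_zeros s = 0%N -> s != [::] ->
  (leading_zeros (shear_seq 1 s) + seq_var 0 (shear_seq 1 s) <= seq_var 0 s)%N.
Proof.
elim: s => // x s IH; rewrite /leading_zeros /= -/(leading_zeros _).
case: (eqVneq x 0) => //= x0 _ _.
rewrite !mul0r !ltxx !add0n mul1r.
have [xh|xh] := eqVneq (x + head 0 s) 0.
  case: s IH xh => [|y s] IH /=; first by rewrite addr0 => /eqP; rewrite (negbTE x0).
  move=> xy; have yx : y = - x by apply/eqP; rewrite -addr_eq0 addrC xy.
  have y0 : y != 0 by rewrite yx oppr_eq0.
  have := IH; rewrite {1}/leading_zeros /= y0 => /(_ erefl isT).
  rewrite !mul0r ltxx add0n -/(leading_zeros _).
  have -> : x * y < 0.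
    by rewrite yx mulrN oppr_lt0 -expr2 exprn_even_gt0.
  by rewrite (negbTE y0) addSn add1n ltnS.
(* Without cancellation at the head no leading zero appears, and the bound is that of
   [seq_var_shear]. *)
rewrite /= add0n.
have := @seq_var_shear 1 0 (x :: s) ler01.
by rewrite /= mul1r (negbTE xh) (negbTE x0) !mul0r ltxx !add0n.
Qed.

(** The last nonzero entry is followed by zeros only, so the shear leaves it unchanged. *)
Lemma has_shear t s : has (fun x => x != 0) s ->
  has (fun x => x != 0) (shear_seq t s).
Proof.
elim: s => //= x s IH; case hs: (has _ s) in IH *.
  by rewrite IH ?orbT.
rewrite orbF => x0; suff -> : head 0 s = 0 by rewrite mulr0 addr0 x0.
by case: s hs {IH} => //= y s; case: eqP.
Qed.

Lemma size_shear t s : size (shear_seq t s) = size s.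
Proof. by elim: s => //= x s ->. Qed.

Lemma nth_shear t s i : nth 0 (shear_seq t s) i = nth 0 s i + t * nth 0 s i.+1.
Proof.
by elim: s i => [|x s IH] [|i] /=; rewrite ?mulr0 ?addr0.
Qed.

Lemma leading_zeros_iter_shear s k m : (size s <= k)%N ->
  has (fun x => x != 0) s -> (seq_var 0 s <= m)%N ->
  (leading_zeros (iter k (shear_seq 1) s) <= m)%N.
Proof.
move=> sk hs vs.
(* Either each of the [j] shears has removed a leading zero, or a sequence with nonzero head has
   been sheared, and from then on leading zeros plus sign changes stay at most [m]. The first
   alternative cannot last for [k >= size s] steps. *)
have key j : has (fun x => x != 0) (iter j (shear_seq 1) s) /\
    let r := iter j (shear_seq 1) s in
    ((leading_zeros r + j <= leading_zeros s)%N /\ (seq_var 0 r <= m)%N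
     \/ (leading_zeros r + seq_var 0 r <= m)%N).
  elim: j => [|j [hj IHj]] /=; first by rewrite addn0; split => //; left.
  set r := iter j _ s in hj IHj *; split; first exact: has_shear.
  have rn : r != [::] by case: (r) hj.
  have v01 := @seq_var_shear 1 0 r ler01.
  case: IHj => [[IH vm]|IH].
    case zr: (leading_zeros r) => [|z].
      right; have := leading_zeros_var_shear zr rn; lia.
    left; rewrite (leading_zeros_shear zr hj); split; last exact: leq_trans v01 _.
    by move: IH; rewrite zr; lia.
  case zr: (leading_zeros r) => [|z].
    right; have := leading_zeros_var_shear zr rn; lia.
  right; rewrite (leading_zeros_shear zr hj); move: IH; rewrite zr addSn => /ltnW.
  by apply: leq_trans; rewrite leq_add2l.
have [_ /= H] := key k.
have : (leading_zeros s < size s)%N by rewrite -has_find.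
by lia.
Qed.

End seq_variation.

(** Replacing entries by zero deletes them from the count. The two sequences may live in different
    domains, so that a real vector can be compared with an integer sign vector. *)
Lemma seq_var_face (F G : realDomainType) (s : seq F) (r : seq G) (a : F) (b : G) :
  size s = size r -> sgz a = sgz b ->
  (forall j, nth 0 s j = 0 \/ sgz (nth 0 s j) = sgz (nth 0 r j)) ->
  (seq_var a s <= seq_var b r)%N.
Proof.
elim: s r a b => [|x s IH] [|y r] a b //= [sr] ab H.
have Hs j := H j.+1.
case: (H 0%N) => /= [->|xy].
  rewrite eqxx; apply: leq_trans (IH r a b sr ab Hs) _.
  exact: seq_var_cons.
rewrite -(sgz_eq0 x) xy sgz_eq0; case: eqP => _; first exact: IH.
by rewrite (mulr_lt0_sgz a x) (mulr_lt0_sgz b y) xy ab leq_add2l IH.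
Qed.

Section rows.
Variable F : realDomainType.
Variable n : nat.
Implicit Types v : 'rV[F]_n.

(** Indexing by natural numbers with default [0] gives a meaning to [i.+1] at the last position and
    spares boundary cases in shears and truncations. *)
Definition entry v (i : nat) : F := nth 0 (entries v) i.

Lemma size_entries v : size (entries v) = n.
Proof. by rewrite size_map size_enum_ord. Qed.

Lemma entryE v (i : 'I_n) : entry v i = v 0 i.
Proof.
by rewrite /entry (nth_map i) ?size_enum_ord // nth_ord_enum.
Qed.

Lemma entry_over v i : (n <= i)%N -> entry v i = 0.
Proof. by move=> ni; rewrite /entry nth_default // size_entries. Qed.

Lemma eq_entry v w : (forall i, entry v i = entry w i) -> v = w.
Proof. by move=> H; apply/rowP => i; rewrite -!entryE. Qed.

Lemma entry_row (f : nat -> F) i :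
  entry (\row_(j < n) f j) i = if (i < n)%N then f i else 0.
Proof.
case: ltnP => ni; last exact: entry_over.
by rewrite -[i]/(nat_of_ord (Ordinal ni)) entryE mxE.
Qed.

Lemma has_entries v : has (fun x => x != 0) (entries v) = (v != 0).
Proof.
apply/idP/idP.
  case/hasP => x /mapP[i _ ->]; apply: contraNneq => ->.
  by rewrite mxE.
apply: contraNT => /hasPn H; apply/eqP/rowP => i; rewrite mxE.
have := H (v 0 i); rewrite negbK => /(_ _)/eqP; apply.
by apply: map_f; rewrite mem_enum.
Qed.

Lemma entry_neq0 v : v != 0 ->
  exists2 i : 'I_n, v 0 i != 0 & forall j : 'I_n, (i < j)%N -> v 0 j = 0.
Proof.
move=> v0; have [i0 vi0] : exists i, v 0 i != 0.
  apply/existsP; apply: contraNT v0; rewrite negb_exists => /forallP H.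
  by apply/eqP/rowP => i; rewrite mxE; apply/eqP; rewrite -[_ == _]negbK.
case: (@arg_maxnP _ i0 (fun i : 'I_n => v 0 i != 0) (@nat_of_ord n) vi0) => i vi imax.
exists i => // j ij; apply/eqP; apply: contraTT ij => vj.
by rewrite -leqNgt; exact: imax.
Qed.

End rows.

Lemma var_face (F G : realDomainType) n (v : 'rV[F]_n) (w : 'rV[G]_n) :
  (forall i, v 0 i = 0 \/ sgz (v 0 i) = sgz (w 0 i)) -> (var v <= var w)%N.
Proof.
move=> H; rewrite !varE; apply: seq_var_face; rewrite ?size_entries ?sgz0 // => j.
rewrite -/(entry v j) -/(entry w j).
have [jn|nj] := ltnP j n; last by left; exact: entry_over.
by rewrite -[j]/(nat_of_ord (Ordinal jn)) !entryE.
Qed.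

Lemma var_sgn (F : realDomainType) n (v : 'rV[F]_n) : var (sgn v) = var v.
Proof.
by apply/eqP; rewrite eqn_leq; apply/andP; split; apply: var_face => i;
  right; rewrite mxE sgz_id.
Qed.

(** * Topology of the projectivization *)

Section matrix_cvg.
Variable (R : realType).

Lemma cvg_row (T : Type) (F : set_system T) (FF : Filter F) n
    (f : T -> 'rV[R]_n) (v : 'rV[R]_n) :
  (forall i, f x 0 i @[x --> F] --> v 0 i) -> f x @[x --> F] --> v.
Proof.
move=> fv A [P vP PA].
have H i : \forall x \near F, P 0 i (f x 0 i) by apply: (fv i); exact: vP.
have : \forall x \near F, forall i, P 0 i (f x 0 i) by exact: filter_forall.
apply: filterS => x Hx; apply: PA => i j; rewrite (ord1 i); exact: Hx.
Qed.

Lemma continuous_row (T : topologicalType) n (f : T -> 'rV[R]_n) :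
  (forall i, continuous (fun x => f x 0 i)) -> continuous f.
Proof. by move=> fc x; apply: cvg_row => i; exact: fc. Qed.

End matrix_cvg.

Section set_type_maps.
Variables (X : topologicalType) (A : set X).

Lemma continuous_into_set_type (Y : topologicalType) (f : Y -> set_type A) :
  continuous (set_val \o f) -> continuous f.
Proof. exact: continuous_comp_initial. Qed.

Lemma continuous_set_val : continuous (set_val : set_type A -> X).
Proof. exact: initial_continuous. Qed.

Lemma set_val_inj : injective (set_val : set_type A -> X).
Proof. by move=> x y; rewrite !set_valE => /val_inj. Qed.

Definition in_set_type x (Ax : A x) : set_type A := exist _ x (mem_set Ax).

Lemma in_set_typeK x (Ax : A x) : set_val (in_set_type Ax) = x.
Proof. by rewrite set_valE. Qed.

End set_type_maps.

Section projective.
Variables (R : realType) (n : nat).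
Local Notation vec := 'rV[R]_n.+1.
Local Notation P := (projectivization R n.+1).
Implicit Types (u v w : vec) (p q : P).

Definition nzv v (v0 : v != 0) : nonzero_vector R n.+1 :=
  @in_set_type _ [set v : vec | v != 0] v v0.

Lemma nzvK v (v0 : v != 0) : set_val (nzv v0) = v.
Proof. exact: in_set_typeK. Qed.

Lemma nonzero_vector_subproof : const_mx 1 != 0 :> vec.
Proof.
by apply/eqP => /rowP/(_ 0); rewrite !mxE => /eqP; rewrite oner_eq0.
Qed.

(* The line spanned by [v]; the value at [v = 0] is an arbitrary line. *)
Definition linev v : P :=
  if pselect (v != 0) is left v0
  then line (nzv v0) else line (nzv nonzero_vector_subproof).

Lemma linevE v (v0 : v != 0) : linev v = line (nzv v0).
Proof.
rewrite /linev; case: pselect => // v0'.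
by congr line; apply: set_val_inj; rewrite !nzvK.
Qed.

Lemma line_linev (x : nonzero_vector R n.+1) : line x = linev (set_val x).
Proof.
have x0 : set_val x != 0 by have := set_valP x.
by rewrite (linevE x0); congr line; apply: set_val_inj; rewrite nzvK.
Qed.

Lemma line_eq (x y : nonzero_vector R n.+1) : line x = line y <->
  exists2 c : R, c != 0 & set_val y = c *: set_val x.
Proof.
split=> [/eqquotP/asboolP//|H].
by apply/eqquotP; apply/asboolP.
Qed.

Lemma linev_eq u v : u != 0 -> v != 0 ->
  linev u = linev v <-> exists2 c : R, c != 0 & v = c *: u.
Proof.
move=> u0 v0; rewrite (linevE u0) (linevE v0) line_eq !nzvK.
by [].
Qed.

Lemma linevZ c v : c != 0 -> linev (c *: v) = linev v.
Proof.
move=> c0; have [->|v0] := eqVneq v 0; first by rewrite scaler0.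
apply/esym/linev_eq => //; first by rewrite scaler_eq0 negb_or c0.
by exists c.
Qed.

Lemma linev_surj p : exists2 v, v != 0 & p = linev v.
Proof.
exists (set_val (repr p : nonzero_vector R n.+1)).
  by have := set_valP (repr p : nonzero_vector R n.+1).
by rewrite -line_linev /line reprK.
Qed.

(** An arbitrary choice of spanning vector, with no claim of continuity; the maps built from it are
    insensitive to rescaling. *)
Definition rep p : vec := xget 0 [set v | v != 0 /\ p = linev v].

Lemma rep_neq0 p : rep p != 0.
Proof.
rewrite /rep; case: xgetP => [v _ []//|H].
by have [v v0 pv] := linev_surj p; case: (H v).
Qed.

Lemma repK p : linev (rep p) = p.
Proof.
rewrite /rep; case: xgetP => [v _ []//|H].
by have [v v0 pv] := linev_surj p; case: (H v).
Qed.

Lemma rep_linev v : v != 0 -> exists2 c : R, c != 0 & rep (linev v) = c *: v.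
Proof.
by move=> v0; apply/linev_eq => //; [exact: rep_neq0|rewrite repK].
Qed.

Lemma open_neq0 : open [set v : vec | v != 0].
Proof.
have -> : [set v : vec | v != 0] = ~` [set 0].
  by apply/seteqP; split => v /= /eqP.
apply: closed_openC; exact: (accessible_closed_set1 (hausdorff_accessible (@norm_hausdorff _ _))).
Qed.

Lemma linev_continuous v : v != 0 -> {for v, continuous linev}.
Proof.
move=> v0 B nB.
have [C [oC Cv] CB] : exists2 C, open_nbhs (linev v) C & C `<=` B.
  by move: nB; rewrite nbhsE.
(* An open set of the quotient pulls back to the trace, on the nonzero vectors, of an open set [W]
   of the whole vector space. *)
have [W oW WE] : open (@line R n.+1 @^-1` C).
  by move: oC; rewrite /open /= /quotient_open.
have nO : nbhs v (W `&` [set v : vec | v != 0]).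
  apply: open_nbhs_nbhs; split; first by apply: openI => //; exact: open_neq0.
  split => //; have : (@line R n.+1 @^-1` C) (nzv v0).
    by rewrite /= -linevE.
  by rewrite -WE /= nzvK.
suff : W `&` [set v : vec | v != 0] `<=` linev @^-1` B by move=> s; exact: filterS s nO.
move=> u [Wu u0]; apply: CB.
have : (set_val @^-1` W) (nzv u0) by rewrite /= nzvK.
by rewrite WE /= -linevE.
Qed.

(** The saturation of an open set of nonzero vectors is the union of its preimages under all nonzero
    scalings, and each of these is open. *)
Lemma linev_open v A : v != 0 -> nbhs v A -> nbhs (linev v) (linev @` A).
Proof.
move=> v0 vA.
have [W [oW Wv] WA] : exists2 W, open_nbhs v W & W `<=` A by move: vA; rewrite nbhsE.
suff : nbhs (linev v) (linev @` (W `&` [set v : vec | v != 0])).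
  by apply: filterS => _ [u [Wu _] <-]; exists u => //; exact: WA.
apply: open_nbhs_nbhs; split; last by exists v.
rewrite /open /= /quotient_open.
exists (\bigcup_(c in [set c : R | c != 0])
          ((fun u : vec => c *: u) @^-1` (W `&` [set v : vec | v != 0]))).
  apply: bigcup_open => c _.
  have /continuousP : continuous (fun u : vec => c *: u) by exact: scaler_continuous.
  by apply; apply: openI => //; exact: open_neq0.
apply/seteqP; split => x /=.
  case=> c c0 [Wu u0]; exists (c *: set_val x) => //.
  by rewrite linevZ // -line_linev.
case=> u [Wu u0]; rewrite -[X in _ = X]/(line x) line_linev => /linev_eq[//||c c0 xE].
  by have := set_valP x.
exists c^-1; first by rewrite /= invr_eq0.
by rewrite /= xE scalerA mulVf // scale1r.
Qed.

(* Continuity on a product with the projectivization can be tested on vectors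
   because [linev] is an open map. *)
Lemma continuous_linev_prod (T Z : topologicalType) (f : P * T -> Z)
    (g : vec * T -> Z) v t : v != 0 ->
  (forall u s, u != 0 -> f (linev u, s) = g (u, s)) ->
  {for (v, t), continuous g} -> {for (linev v, t), continuous f}.
Proof.
move=> v0 fg gc B; rewrite /= fg // => /gc [[A1 A2] /= [nA1 nA2] AB].
exists (linev @` (A1 `&` [set v : vec | v != 0]), A2) => /=.
  split => //; apply: linev_open => //; apply: filterI => //.
  by apply: open_nbhs_nbhs; split => //; exact: open_neq0.
by move=> [p s] /= [[u [Au u0] <-] As]; rewrite fg //; apply: (AB (u, s)).
Qed.

Lemma continuous_linev (Z : topologicalType) (f : P -> Z) (g : vec -> Z) v :
  v != 0 -> (forall u, u != 0 -> f (linev u) = g u) ->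
  {for v, continuous g} -> {for linev v, continuous f}.
Proof.
move=> v0 fg gc B; rewrite /= fg // => /gc nA.
have nA' : nbhs v ((g @^-1` B) `&` [set v : vec | v != 0]).
  apply: filterI => //.
  by apply: open_nbhs_nbhs; split => //; exact: open_neq0.
have H := linev_open v0 nA'.
suff s : linev @` ((g @^-1` B) `&` [set v : vec | v != 0]) `<=` f @^-1` B.
  exact: filterS s H.
by move=> p [u [Bu u0] <-]; rewrite /= fg.
Qed.

Lemma sqnorm_gt0 v : v != 0 -> 0 < sqnorm v.
Proof.
case/entry_neq0 => i vi _; rewrite /sqnorm (bigD1 i) //=.
by rewrite ltr_pwDl ?sumr_ge0 // => [|j _]; rewrite ?sqr_ge0 // exprn_even_gt0.
Qed.

Lemma sqnorm_continuous k : continuous (@sqnorm R k).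
Proof.
move=> v; apply: (@continuous_big _ _ _ _ _ add_continuous) => i _ {}v.
apply: (@continuous_comp _ _ _ (fun x : 'rV[R]_k => x 0 i) (fun x => x ^+ 2)).
  exact: coord_continuous.
exact: exprn_continuous.
Qed.

Lemma sqnormZ k (c : R) (v : 'rV[R]_k) : sqnorm (c *: v) = c ^+ 2 * sqnorm v.
Proof.
by rewrite /sqnorm mulr_sumr; apply: eq_bigr => i _; rewrite mxE exprMn.
Qed.

(* The entries of the orthogonal projection onto a line separate lines. *)
Lemma projectivization_hausdorff : hausdorff_space P.
Proof.
move=> p q pq.
pose G i j (v : vec) : R := v 0 i * v 0 j / sqnorm v.
have Gc i j v : v != 0 -> {for v, continuous (G i j)}.
  move=> v0.
  have c k : {for v, continuous (fun v : vec => v 0 k)} by exact: coord_continuous.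
  have cV : {for v, continuous (fun v : vec => (sqnorm v)^-1)}.
    have sv : sqnorm v != 0 by rewrite gt_eqF // sqnorm_gt0.
    exact: (cvgV sv (@sqnorm_continuous _ v)).
  exact: (continuousM (continuousM (c i) (c j)) cV).
have GZ i j u c : c != 0 -> G i j (c *: u) = G i j u.
  move=> c0; rewrite /G sqnormZ !mxE invfM.
  have : (c ^+ 2)^-1 * c ^+ 2 = 1 by rewrite mulVf ?expf_neq0.
  move: (c ^+ 2)^-1 (sqnorm u)^-1 => a b ac.
  by rewrite -[RHS]mul1r -ac; ring.
have Fl i j u : u != 0 -> (G i j \o rep) (linev u) = G i j u.
  by move=> u0 /=; have [c c0 ->] := rep_linev u0; rewrite GZ.
have Fc i j r : {for r, continuous (G i j \o rep)}.
  have [v v0 ->] := linev_surj r.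
  exact: (continuous_linev v0 (Fl i j) (Gc i j v v0)).
have FE i j : (G i j \o rep) p = (G i j \o rep) q.
  apply: (@norm_hausdorff R R) => A B /Fc nA /Fc nB.
  by have [x [Ax Bx]] := pq _ _ nA nB; exists ((G i j \o rep) x).
rewrite -(repK p) -(repK q).
move: FE; rewrite /= /G; move: (rep p) (rep q) (rep_neq0 p) (rep_neq0 q).
move=> v w v0 w0 FE; apply/linev_eq => //.
have [i vi _] := entry_neq0 v0.
have sv := lt0r_neq0 (sqnorm_gt0 v0); have sw := lt0r_neq0 (sqnorm_gt0 w0).
have wi : w 0 i != 0.
  apply: contra_eq_neq (FE i i) => ->.
  by rewrite mulr0 mul0r !mulf_neq0 // invr_eq0.
(* The factor comes from solving [v_i v_j / |v|^2 = w_i w_j / |w|^2] for [w_j], with [i] fixed such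
   that [v_i] and [w_i] are nonzero. *)
exists (v 0 i * sqnorm w / (w 0 i * sqnorm v)).
  by rewrite !mulf_neq0 ?invr_eq0 ?mulf_neq0.
apply/rowP => j; rewrite mxE.
have /eqP := FE i j; rewrite (eqr_div _ _ sv sw) => /eqP E.
apply: (@mulfI _ (w 0 i * sqnorm v)); first by rewrite mulf_neq0.
rewrite mulrA [_ * (_ / _)]mulrC divfK; last by rewrite mulf_neq0.
by move: E; lra.
Qed.

End projective.

(** * Cells and their closures *)

Section sign_vectors.
Variable R : realType.
Variable n : nat.
Implicit Types (s t w : 'rV[int]_n) (v : 'rV[R]_n).

Definition sign_le t s := forall i, t 0 i = 0 \/ t 0 i = s 0 i.

Definition of_sign w : 'rV[R]_n := map_mx intr w.

Lemma sign_vectorP w : sign_vector w <-> sgn w = w.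
Proof.
split=> [H|H i].
  apply/rowP => i; rewrite mxE; move: (H i); rewrite !inE.
  by case/or3P => /eqP ->.
by rewrite -H mxE; case: sgzP; rewrite !inE eqxx ?orbT.
Qed.

Lemma sgn_of_sign w : sign_vector w -> sgn (of_sign w) = w.
Proof.
move=> /sign_vectorP H; rewrite -[RHS]H; apply/rowP => i; rewrite !mxE.
by case: (sgzP (w 0 i)) => h; [rewrite h sgz0|apply: gtr0_sgz; rewrite ltr0z|
  apply: ltr0_sgz; rewrite ltrz0].
Qed.

Lemma sign_vector_sgn v : sign_vector (sgn v).
Proof. by move=> i; rewrite mxE; case: sgzP; rewrite !inE eqxx ?orbT. Qed.

Lemma sign_vectorN w : sign_vector w -> sign_vector (- w).
Proof.
move=> H i; move: (H i); rewrite mxE !inE => /or3P[] /eqP ->;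
  by rewrite ?opprK ?oppr0 eqxx ?orbT.
Qed.

Lemma sgn_eq0 v : (sgn v == 0) = (v == 0).
Proof.
apply/eqP/eqP => [/rowP H|->]; apply/rowP => i; rewrite !mxE ?sgz0 //.
by have := H i; rewrite !mxE => /eqP; rewrite sgz_eq0 => /eqP.
Qed.

Lemma of_sign_eq0 w : (of_sign w == 0) = (w == 0).
Proof.
apply/eqP/eqP => [/rowP H|->]; apply/rowP => i; rewrite !mxE //.
by have /eqP := H i; rewrite !mxE intr_eq0 => /eqP.
Qed.

Lemma sgnZ (c : R) v : sgn (c *: v) = sgz c *: sgn v.
Proof. by apply/rowP => i; rewrite !mxE sgzM. Qed.

Lemma sgnN v : sgn (- v) = - sgn v.
Proof. by apply/rowP => i; rewrite !mxE sgzN. Qed.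

Lemma sign_leN t s : sign_le t s -> sign_le (- t) (- s).
Proof. by move=> H i; rewrite !mxE; case: (H i) => ->; [rewrite oppr0; left|right]. Qed.

Lemma sign_le_var t s : sign_le t s -> (var t <= var s)%N.
Proof. by move=> H; apply: var_face => i; case: (H i) => ->; [left|right]. Qed.

Lemma varN (F : realDomainType) (v : 'rV[F]_n) : var (- v) = var v.
Proof.
rewrite !varE /entries.
suff H r (a b : F) : sgz a = - sgz b ->
    seq_var a [seq (- v) 0 i | i <- r] = seq_var b [seq v 0 i | i <- r].
  by apply: H; rewrite !sgz0 oppr0.
elim: r a b => //= i r IH a b ab; rewrite mxE oppr_eq0 (IH a b ab).
rewrite (mulr_lt0_sgz a) ab (mulr_lt0_sgz b (v 0 i)) sgzN mulrNN.
by rewrite (IH (- v 0 i) (v 0 i)) // sgzN.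
Qed.

End sign_vectors.

Arguments of_sign R {n} w.

Section cells.
Variables (R : realType) (n : nat).
Local Notation vec := 'rV[R]_n.+1.
Local Notation P := (projectivization R n.+1).
Local Notation cell := (@U R n.+1).
Implicit Types (s t w : 'rV[int]_n.+1) (v : vec).

Lemma U_linev w v : v != 0 -> cell w (linev v) <-> sgn v = w \/ sgn v = - w.
Proof.
move=> v0; split.
  case=> x /= xw; rewrite line_linev => /linev_eq[]//.
    by have := set_valP x.
  move=> c c0 ->; rewrite sgnZ xw; case: (sgzP c) c0 => // _ _.
  - by rewrite scale1r; left.
  - by rewrite scaleN1r; right.
case=> vw; first by exists (nzv v0); [rewrite /= nzvK|rewrite -linevE].
have Nv0 : - v != 0 by rewrite oppr_eq0.
exists (nzv Nv0); first by rewrite /= nzvK sgnN vw opprK.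
by rewrite -linevE -scaleN1r linevZ // oppr_eq0 oner_eq0.
Qed.

Lemma U_of_sign w : sign_vector w -> w != 0 -> cell w (linev (of_sign R w)).
Proof.
by move=> sw w0; apply/U_linev; rewrite ?of_sign_eq0 // sgn_of_sign //; left.
Qed.

Lemma U_opp w : cell (- w) = cell w.
Proof.
apply/seteqP; split => p; have [v v0 ->] := linev_surj p;
  by rewrite !U_linev // opprK => -[]; [right|left].
Qed.

Lemma U_inj t s : sign_vector t -> t != 0 -> cell t = cell s -> t = s \/ t = - s.
Proof.
move=> st t0 ts; have := U_of_sign st t0.
by rewrite ts U_linev ?of_sign_eq0 // sgn_of_sign.
Qed.

Lemma U_meet_inj t s p : cell t p -> cell s p -> cell t = cell s.
Proof.
have [v v0 ->] := linev_surj p.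
rewrite !U_linev // => -[->|vt].
  by case=> ->; rewrite ?U_opp.
by move: vt => /esym /eqP; rewrite eqr_oppLR => /eqP ->; case=> ->; rewrite ?opprK ?U_opp.
Qed.

(** A nonzero entry of [v] keeps its sign nearby. If that sign disagrees with [s], then no vector
    near [v] has sign vector [s]; the same holds for [- s]. *)
Lemma sgn_near_le v s : (\forall u \near v, sgn u = s \/ sgn u = - s -> False) \/
  (sign_le (sgn v) s \/ sign_le (sgn v) (- s)).
Proof.
have key r : (\forall u \near v, sgn u = r -> False) \/ sign_le (sgn v) r.
  have [H|/existsNP[i]] := pselect (sign_le (sgn v) r); [by right|].
  move=> /not_orP[]; rewrite !mxE => vi0 vir; left.
  have ci : (fun u : vec => u 0 i) u @[u --> v] --> v 0 i by exact: coord_continuous.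
  case: (sgzP (v 0 i)) vi0 vir => // vi _ vir.
    apply: filterS (cvgr_gt _ ci _ vi) => u ui ur.
    by apply: vir; rewrite -ur mxE gtr0_sgz.
  apply: filterS (cvgr_lt _ ci _ vi) => u ui ur.
  by apply: vir; rewrite -ur mxE ltr0_sgz.
case: (key s) => [H1|]; last by right; left.
case: (key (- s)) => [H2|]; last by right; right.
by left; apply: filterS2 H1 H2 => u a b [].
Qed.

Lemma closure_U s v : sign_vector s -> v != 0 ->
  closure (cell s) (linev v) <-> sign_le (sgn v) s \/ sign_le (sgn v) (- s).
Proof.
move=> ss v0; split.
  move=> cl; case: (sgn_near_le v s) => // H; exfalso.
  have nz : \forall u \near v, u != 0.
    by apply: open_nbhs_nbhs; split => //; exact: open_neq0.
  have [p [Up [u [us u0] up]]] := cl _ (linev_open v0 (filterI H nz)).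
  by apply: us; apply/U_linev => //; rewrite up.
suff key r : sign_vector r -> sign_le (sgn v) r -> closure (cell r) (linev v).
  by case=> H; [exact: key|rewrite -U_opp; apply: key => //; exact: sign_vectorN].
move=> sr vr B /(linev_continuous v0)/nbhs_ballP[e /= e0 eB].
have e20 : 0 < e / 2 by rewrite divr_gt0.
(* A small step towards [r] gives the vanishing entries of [v] the signs of [r] and preserves the
   signs of the others. The factor [e / 2] keeps [u] strictly inside the ball. *)
pose u := v + (e / 2) *: of_sign R r.
have su : sgn u = r.
  apply/rowP => i; rewrite !mxE -[RHS]/(r 0 i).
  have := vr i; rewrite mxE; have := sr i; rewrite !inE.
  case/or3P => /eqP ->; case: (sgzP (v 0 i)) => vi; case=> // _.
  - by rewrite vi add0r; apply: ltr0_sgz; rewrite mulrN1 oppr_lt0.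
  - by apply: ltr0_sgz; rewrite mulrN1; lra.
  - by rewrite vi mulr0 addr0 sgz0.
  - by rewrite vi mulr0 addr0 sgz0.
  - by rewrite vi add0r mulr1; apply: gtr0_sgz.
  - by apply: gtr0_sgz; rewrite mulr1 addr_gt0.
have u0 : u != 0.
  rewrite -sgn_eq0 su; apply: contraNneq v0 => r0.
  rewrite -sgn_eq0; apply/eqP/rowP => i; case: (vr i) => ->; rewrite ?r0 !mxE //.
exists (linev u); split; first by apply/U_linev => //; left.
apply: eB; split => // i j; rewrite !mxE (ord1 i) /ball /= opprD addNKr normrN.
have : `|(r 0 j)%:~R : R| <= 1.
  by have := sr j; rewrite !inE => /or3P[] /eqP ->; rewrite ?normrN ?normr1 ?normr0.
move=> r1; rewrite normrM (gtr0_norm e20); apply: (@le_lt_trans _ _ (e / 2)).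
  by rewrite -[leRHS]mulr1 ler_wpM2l // ltW.
by rewrite ltr_pdivrMr // ltr_pMr // ltr1n.
Qed.

Lemma face_U t s : sign_vector t -> t != 0 -> sign_vector s ->
  face (cell t) (cell s) <-> sign_le t s \/ sign_le t (- s).
Proof.
move=> st t0 ss; split.
  by move=> /(_ _ (U_of_sign st t0)); rewrite closure_U ?of_sign_eq0 // sgn_of_sign.
move=> H p; have [v v0 ->] := linev_surj p; rewrite U_linev // closure_U //.
case=> ->; first by [].
by case: H => H; [right|left]; [|rewrite -[s]opprK]; exact: sign_leN.
Qed.

Lemma RP_cellsP (e : set P) : RP_cells R n e ->
  exists w, [/\ sign_vector w, w != 0 & e = cell w].
Proof. by case=> w [sw w0] <-; exists w. Qed.

Lemma closure_U_cells s p : sign_vector s ->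
  closure (cell s) p -> exists w, [/\ sign_vector w, w != 0, sign_le w s & cell w p].
Proof.
move=> ss; have [v v0 ->] := linev_surj p; rewrite closure_U // => H.
have sv := sign_vector_sgn v; have sv0 : sgn v != 0 by rewrite sgn_eq0.
case: H => H; first by exists (sgn v); split => //; apply/U_linev => //; left.
exists (- sgn v); split => //; first exact: sign_vectorN.
- by rewrite oppr_eq0.
- by rewrite -[s]opprK; exact: sign_leN.
- by apply/U_linev => //; right; rewrite opprK.
Qed.

End cells.

(** * Characteristic maps *)

Section disk_to_simplex.
Variables (R : realType) (d : nat).
Implicit Types (x : 'rV[R]_d) (k : 'I_d.+1).

(** The quotient of [d.+1]-space by [(1, ..., 1)] is identified with [d]-space by normalizing the
    coordinate [ord0] to zero. *)
Definition coord0 x k : R := if unlift ord0 k is Some i then x 0 i else 0.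

(** The initial value [0] of the minimum is the coordinate at [ord0]. *)
Definition coord_min x : R := \big[Num.min/0]_i x 0 i.

Definition eucl_norm x : R := Num.sqrt (sqnorm x).

(* Homogeneous coordinates, up to a positive factor, of a point of the simplex:
   the class of [x] modulo [(1, ..., 1)] is kept and the smallest coordinate
   is set to [1 - |x|], so that the sphere goes to the boundary. *)
Definition simplex_coord x k : R := coord0 x k - coord_min x + (1 - eucl_norm x).

Lemma coord0_0 x : coord0 x ord0 = 0.
Proof. by rewrite /coord0 unlift_none. Qed.

Lemma coord0_lift x i : coord0 x (lift ord0 i) = x 0 i.
Proof. by rewrite /coord0 liftK. Qed.

Lemma coord0Z c x k : coord0 (c *: x) k = c * coord0 x k.
Proof. by rewrite /coord0; case: unlift => [i|]; rewrite ?mulr0 // mxE. Qed.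

Lemma coord_min_le x k : coord_min x <= coord0 x k.
Proof.
rewrite /coord0 /coord_min; case: unlift => [i|]; first exact: bigmin_le.
exact: bigmin_le_id.
Qed.

Lemma coord_min_attained x : exists k, coord0 x k = coord_min x.
Proof.
rewrite /coord_min; elim/big_ind: _ => [|a b [k ka] [l lb]|i _].
- by exists ord0; rewrite coord0_0.
- by rewrite /Num.min; case: ifP => _; [exists k|exists l].
- by exists (lift ord0 i); rewrite coord0_lift.
Qed.

Lemma coord_min_unique x b : (forall k, b <= coord0 x k) ->
  (exists k, coord0 x k = b) -> coord_min x = b.
Proof.
move=> bx [k kb]; apply/eqP; rewrite eq_le -{1}kb coord_min_le /=.
by have [l <-] := coord_min_attained x.
Qed.

Lemma coord_minZ c x : 0 < c -> coord_min (c *: x) = c * coord_min x.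
Proof.
move=> c0; apply: coord_min_unique => [k|].
  by rewrite coord0Z ler_pM2l // coord_min_le.
by have [k <-] := coord_min_attained x; exists k; rewrite coord0Z.
Qed.

Lemma eucl_normZ c x : 0 < c -> eucl_norm (c *: x) = c * eucl_norm x.
Proof.
move=> c0; rewrite /eucl_norm sqnormZ sqrtrM ?sqr_ge0 // sqrtr_sqr.
by rewrite gtr0_norm.
Qed.

Lemma eucl_norm_ge0 x : 0 <= eucl_norm x. Proof. exact: sqrtr_ge0. Qed.

Lemma sqnorm_ge0 x : 0 <= sqnorm x.
Proof. by apply: sumr_ge0 => i _; exact: sqr_ge0. Qed.

Lemma closed_diskP x : closed_disk x <-> eucl_norm x <= 1.
Proof.
rewrite /closed_disk /= /eucl_norm; split=> H.
  by rewrite -[leRHS]sqrtr1 ler_wsqrtr.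
by rewrite -(sqr_sqrtr (sqnorm_ge0 x)) expr_le1 // sqrtr_ge0.
Qed.

Lemma open_diskP x : open_disk x <-> eucl_norm x < 1.
Proof.
rewrite /open_disk /= /eucl_norm; split=> H.
  by rewrite -[ltRHS]sqrtr1 ltr_sqrt.
by rewrite -(sqr_sqrtr (sqnorm_ge0 x)) expr_lt1 // sqrtr_ge0.
Qed.

Lemma unit_sphere_norm x : unit_sphere x -> eucl_norm x = 1.
Proof. by rewrite /unit_sphere /= /eucl_norm => ->; rewrite sqrtr1. Qed.

Lemma simplex_coord_ge x k : 1 - eucl_norm x <= simplex_coord x k.
Proof. by rewrite lerDr subr_ge0 coord_min_le. Qed.

Lemma simplex_coord_attained x : exists k, simplex_coord x k = 1 - eucl_norm x.
Proof.
have [k kx] := coord_min_attained x; exists k.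
by rewrite /simplex_coord kx subrr add0r.
Qed.

(** If all coordinates vanish, then they are equal, so [x = 0]; but at [x = 0] the smallest
    coordinate is [1]. *)
Lemma simplex_coord_neq0 x : exists k, simplex_coord x k != 0.
Proof.
apply: contrapT => /forallNP H.
have {}H k : simplex_coord x k = 0 by apply/eqP/negPn/negP; exact: H.
have x0 : x = 0.
  apply/rowP => i; rewrite mxE -coord0_lift.
  have := H (lift ord0 i); have := H ord0; rewrite /simplex_coord coord0_0; lra.
have [k] := simplex_coord_attained x.
rewrite H x0 /eucl_norm /sqnorm big1 ?sqrtr0 ?subr0 => [/eqP|i _].
  by rewrite eq_sym oner_eq0.
by rewrite mxE expr0n.
Qed.

(** Coordinates on the closed disk are nonnegative, so [c > 0]. Their differences give
    [x' = c *: x]. Everything but the constant [1] in [simplex_coord] is positively homogeneous, and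
    comparing the constants gives [c = 1]. *)
Lemma simplex_coord_inj x x' c : closed_disk x -> closed_disk x' -> c != 0 ->
  (forall k, simplex_coord x' k = c * simplex_coord x k) -> x = x'.
Proof.
move=> /closed_diskP x1 /closed_diskP x1' cn0 H.
have [k xk0] := simplex_coord_neq0 x.
have xk : 0 < simplex_coord x k.
  by rewrite lt_def xk0 (le_trans _ (simplex_coord_ge _ _)) // subr_ge0.
have c0 : 0 < c.
  rewrite lt_def cn0 -(pmulr_lge0 _ xk) -H (le_trans _ (simplex_coord_ge _ _)) //.
  by rewrite subr_ge0.
have x'E : x' = c *: x.
  apply/rowP => i; rewrite mxE -!coord0_lift.
  have := H (lift ord0 i); have := H ord0; rewrite /simplex_coord !coord0_0; lra.
have := H ord0; rewrite /simplex_coord !coord0_0 x'E eucl_normZ // coord_minZ //.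
move=> E; have -> : c = 1 by move: E; lra.
by rewrite scale1r.
Qed.

Lemma simplex_coord_surj (y : 'I_d.+1 -> R) : (forall k, 0 < y k) ->
  exists2 x, open_disk x & exists2 c, 0 < c & forall k, simplex_coord x k = c * y k.
Proof.
move=> y0; pose x0 : 'rV[R]_d := \row_i (y (lift ord0 i) - y ord0).
have x0E k : coord0 x0 k = y k - y ord0.
  case: (unliftP ord0 k) => [i|] ->; last by rewrite coord0_0 subrr.
  by rewrite coord0_lift mxE.
have [l lx0] := coord_min_attained x0.
have den : 0 < y l + eucl_norm x0 by rewrite ltr_wpDr ?eucl_norm_ge0.
(* This scale turns the smallest coordinate [c * y l] into [1 - |c *: x0|], as the definition of
   [simplex_coord] requires. *)
pose c := (y l + eucl_norm x0)^-1.
have c0 : 0 < c by rewrite invr_gt0.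
have cE : c * y l + c * eucl_norm x0 = 1 by rewrite -mulrDr mulVf // gt_eqF.
exists (c *: x0).
  apply/open_diskP; rewrite eucl_normZ //.
  by have := mulr_gt0 c0 (y0 l); lra.
exists c => // k; rewrite /simplex_coord coord0Z coord_minZ // eucl_normZ //.
rewrite -lx0 !x0E; lra.
Qed.

Lemma simplex_coord_continuous k : continuous (fun x => simplex_coord x k).
Proof.
have c1 : continuous (fun x => coord0 x k).
  rewrite /coord0; case: unlift => [i|]; last exact: cst_continuous.
  exact: coord_continuous.
have c2 : continuous coord_min.
  by apply: (continuous_big (@min_continuous _ R)) => i _; exact: coord_continuous.
have c3 : continuous eucl_norm.
  move=> x; apply: (@continuous_comp _ _ _ (@sqnorm R d) (@Num.sqrt R)).
    exact: sqnorm_continuous.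
  exact: sqrt_continuous.
have c4 : continuous (fun _ : 'rV[R]_d => 1 : R) by exact: cst_continuous.
have H x := continuousD (continuousB (c1 x) (c2 x)) (continuousB (c4 x) (c3 x)).
exact: H.
Qed.

End disk_to_simplex.

(** * The regular cell structure of projective space *)

Section regular_cells.
Variables (R : realType) (n : nat).
Local Notation vec := 'rV[R]_n.+1.
Local Notation P := (projectivization R n.+1).
Local Notation cell := (@U R n.+1).
Implicit Types (s t w : 'rV[int]_n.+1) (v : vec).

Definition supp w : {set 'I_n.+1} := [set i | w 0 i != 0]%SET.

Lemma supp_gt0 w : w != 0 -> (0 < #|supp w|)%N.
Proof.
case/entry_neq0 => i wi _; rewrite card_gt0; apply/set0Pn; exists i.
by rewrite inE.
Qed.

Lemma suppN w : supp (- w) = supp w.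
Proof. by apply/setP => i; rewrite !inE mxE oppr_eq0. Qed.

Lemma supp_subset t s : sign_le t s -> supp t \subset supp s.
Proof.
by move=> ts; apply/fintype.subsetP => i; rewrite !inE; case: (ts i) => ->.
Qed.

Lemma supp_enum w d : #|supp w| = d.+1 -> exists2 e : 'I_d.+1 -> 'I_n.+1,
  injective e & forall j, (w 0 j != 0) <-> exists k, e k = j.
Proof.
move=> wd; exists (fun k => enum_val (cast_ord (esym wd) k)).
  by move=> i j /enum_val_inj/cast_ord_inj.
move=> j; split=> [wj|[k <-]]; last by have := enum_valP (cast_ord (esym wd) k); rewrite inE.
have jA : j \in supp w by rewrite inE.
exists (cast_ord wd (enum_rank_in jA j)).
by rewrite cast_ordK enum_rankK_in.
Qed.

(** The disk is mapped to the simplex by [simplex_coord], and the coordinates are placed on the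
    support of [w] with the signs of [w]. The last clause compares supports because their sizes give
    the dimensions. *)
Lemma characteristic_map w d : sign_vector w -> #|supp w| = d.+1 ->
  exists2 phi : 'rV[R]_d -> P, regular_characteristic_map (cell w) phi &
    forall x, unit_sphere x -> closure (cell w) (phi x) /\
      forall t, cell t (phi x) -> (#|supp t| < #|supp w|)%N.
Proof.
move=> sw wd; have [e e_inj eP] := supp_enum wd.
have we k : w 0 (e k) != 0 by apply/eP; exists k.
have we2 k : (w 0 (e k))%:~R * (w 0 (e k))%:~R = 1 :> R.
  by move: (we k) (sw (e k)); rewrite !inE => /negbTE -> /or3P[]// /eqP ->;
    rewrite ?mulrNN mulr1.
pose place (y : 'I_d.+1 -> R) : vec :=
  \row_j ((w 0 j)%:~R * \sum_k y k * (e k == j)%:R).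
have placeE y k : place y 0 (e k) = (w 0 (e k))%:~R * y k.
  rewrite mxE (bigD1 k) //= eqxx mulr1 big1 ?addr0 // => l /negbTE lk.
  by rewrite (inj_eq e_inj) lk mulr0.
have place0 y j : w 0 j = 0 -> place y 0 j = 0.
  by move=> wj; rewrite mxE wj mul0r.
have sgz_place y k : sgz (place y 0 (e k)) = w 0 (e k) * sgz (y k).
  rewrite placeE sgzM; congr (_ * _).
  by have := sgn_of_sign R sw => /rowP/(_ (e k)); rewrite !mxE.
have place_sgn y : (forall k, 0 <= y k) -> sign_le (sgn (place y)) w.
  move=> y0 j; have [wj|wj] := eqVneq (w 0 j) 0.
    by left; rewrite mxE place0 // sgz0.
  have /eP[k <-] := wj; rewrite mxE sgz_place.
  by have := y0 k; case: (sgzP (y k)) => // _ _; [left|right]; rewrite ?mulr0 ?mulr1.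
pose f x := place (simplex_coord x).
have f0 x : f x != 0.
  have [k xk] := simplex_coord_neq0 x.
  apply: contra_neq xk => /rowP/(_ (e k)); rewrite placeE mxE => /eqP.
  by rewrite mulf_eq0 intr_eq0 (negbTE (we k)) => /eqP.
have fc : continuous f.
  apply: continuous_row => j x.
  have -> : (fun z => f z 0 j) = (fun z => (w 0 j)%:~R *
      \sum_k simplex_coord z k * (e k == j)%:R).
    by apply/funext => z; rewrite mxE.
  have cs : continuous (fun z : 'rV[R]_d => \sum_k simplex_coord z k * (e k == j)%:R).
    move=> z; apply: (@continuous_big _ _ _ _ _ add_continuous) => k _ z'.
    exact: (cvgM (@simplex_coord_continuous R d k z') (@cvg_cst _ _ _ _ _)).
  exact: (cvgM (@cvg_cst _ _ _ _ _) (cs x)).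
exists (@linev R n \o f).
  split.
  - apply: continuous_subspaceT => x; apply: continuous_comp; first exact: fc.
    exact: linev_continuous.
  - move=> x x' /set_mem x1 /set_mem x1' /linev_eq[]// c c0 /rowP ff.
    apply: (simplex_coord_inj x1 x1' c0) => k.
    have := ff (e k); rewrite [X in _ = X]mxE /f !placeE.
    move=> /(congr1 (fun z => (w 0 (e k))%:~R * z)).
    by rewrite (mulrCA _ c) !(mulrA (w 0 (e k))%:~R) !we2 !mul1r.
  - apply/seteqP; split=> [_ [x /open_diskP x1 <-]|p].
      apply/U_linev => //; left; apply/rowP => j.
      have [wj|wj] := eqVneq (w 0 j) 0; first by rewrite mxE place0 // sgz0 wj.
      have /eP[k <-] := wj; rewrite mxE sgz_place gtr0_sgz ?mulr1 //.
      by apply: lt_le_trans (simplex_coord_ge _ _); rewrite subr_gt0.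
    have [v v0 ->] := linev_surj p.
    (* A line of the cell is spanned by a vector whose sign vector is [w] itself rather than
       [- w]. *)
    suff key (u : vec) : u != 0 -> sgn u = w ->
        ([set (@linev R n \o f) x | x in @open_disk R d]) (linev u).
      rewrite U_linev // => -[|vw]; first exact: key.
      rewrite -(@linevZ R n (-1) v) ?oppr_eq0 ?oner_eq0 // scaleN1r.
      by apply: key; rewrite ?oppr_eq0 // sgnN vw opprK.
    move=> u0 uw.
    have y0 k : 0 < (w 0 (e k))%:~R * u 0 (e k).
      rewrite -sgz_gt0 sgzM -uw mxE.
      move: (we k); rewrite -uw mxE; case: sgzP => // _ _.
        by rewrite sgz1 mulr1.
      by rewrite mulrN1 sgzN sgz1 opprK.
    have [x x1 [c c0 xE]] := simplex_coord_surj y0.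
    exists x => //=; suff -> : f x = c *: u by rewrite linevZ // gt_eqF.
    apply/rowP => j; rewrite [RHS]mxE.
    have [wj|wj] := eqVneq (w 0 j) 0.
      rewrite place0 //; move/rowP/(_ j): uw; rewrite wj mxE => /eqP.
      by rewrite sgz_eq0 => /eqP ->; rewrite mulr0.
    by have /eP[k <-] := wj; rewrite placeE xE (mulrCA _ c) (mulrA (w 0 (e k))%:~R) we2 mul1r.
move=> x /unit_sphere_norm x1.
have y0 k : 0 <= simplex_coord x k.
  by apply: le_trans (simplex_coord_ge _ _); rewrite x1 subrr.
have fw : sign_le (sgn (f x)) w by exact: place_sgn.
split; first by apply/closure_U => //; left.
move=> t /U_linev-/(_ (f0 x)) ft.
have -> : supp t = supp (sgn (f x)) by case: ft => ->; rewrite ?suppN.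
apply: proper_card; rewrite fintype.properE (supp_subset fw) /=.
(* On the sphere the smallest coordinate is [1 - 1 = 0], so the image loses a position of the
   support of [w]. *)
have [k xk] := simplex_coord_attained x.
apply/fintype.subsetPn; exists (e k); rewrite inE ?we // negbK mxE sgz_eq0 placeE.
by rewrite xk x1 subrr mulr0.
Qed.

(** The dimension has to be a function of the set, so a sign vector is chosen. It is determined by
    the cell up to sign, which does not affect the support. *)
Definition cell_dim (e : set P) : nat :=
  #|supp (xget 0 [set w | [/\ sign_vector w, w != 0 & e = cell w]])|.-1.

Lemma cell_dimE w : sign_vector w -> w != 0 -> cell_dim (cell w) = #|supp w|.-1.
Proof.
move=> sw w0; rewrite /cell_dim; case: xgetP => [t _ [st t0 tw]|/(_ w)].
  by case: (U_inj sw w0 tw) => ->; rewrite ?suppN.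
by case.
Qed.

Lemma finite_sign_vector : finite_set (@sign_vector n.+1).
Proof.
apply: (@sub_finite_set _ _ ((fun f : {ffun 'I_n.+1 -> 'I_3} =>
   \row_i ((f i : nat)%:Z - 1)) @` setT)); last first.
  by apply: finite_image; exact: finite_finset.
move=> w sw; exists [ffun i => inord (absz (w 0 i + 1)%R)] => //.
apply/rowP => i; rewrite mxE ffunE.
by have := sw i; rewrite !inE => /or3P[] /eqP ->; rewrite inordK.
Qed.

Lemma RP_cells_finite : finite_set (RP_cells R n).
Proof.
apply: finite_image; apply: sub_finite_set finite_sign_vector.
by move=> w [].
Qed.

(** The image of the sphere lies in the closure of the cell, which [K] covers, and the cells met
    there have smaller support. Applied to each stage of a collapse, this shows that the deformation
    runs through regular complexes. *)
Lemma subcomplex_regular_CW (K : set (set P)) :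
  subcomplex K (RP_cells R n) -> regular_CW R K.
Proof.
move=> [KR Kcl]; split.
- exact: projectivization_hausdorff.
- by apply: sub_finite_set KR _; exact: RP_cells_finite.
- apply/trivIsetP => e e' /KR/RP_cellsP[w [_ _ ->]] /KR/RP_cellsP[t [_ _ ->]].
  move=> /eqP wt; apply/seteqP; split => // p [wp tp]; apply: wt.
  exact: U_meet_inj wp tp.
exists cell_dim => e Ke; have := Ke => /KR/RP_cellsP[w [sw w0 ew]].
have := supp_gt0 w0; rewrite ew cell_dimE //.
case wd: #|supp w| => [|d] // _; rewrite [d.+1.-1]/=.
have [phi rphi bd] := characteristic_map sw wd.
exists phi => // x /bd[clx xt].
have [e' Ke' xe'] := Kcl _ Ke (phi x) (eq_ind_r (fun z => closure z _) clx ew).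
exists e' => //; split => //.
have [t [st t0 et]] := RP_cellsP (KR _ Ke').
have := supp_gt0 t0; rewrite et cell_dimE //.
by have := xt t; rewrite -et wd => /(_ xe'); lia.
Qed.

End regular_cells.

(** * Collapsing *)

Section collapsing.
Variable X : topologicalType.
Implicit Types (K L : set (set X)) (e : set X).

Lemma face_refl e : face e e.
Proof. exact: subset_closure. Qed.

Lemma face_trans e1 e2 e3 : face e1 e2 -> face e2 e3 -> face e1 e3.
Proof.
move=> e12 e23 x /e12 /(closure_subset e23).
by rewrite -(proj1 (closure_id _) (@closed_closure _ e3)).
Qed.

(* The pairs [(a x, b x)] are removed in the order of increasing rank. *)
Lemma collapses_pairs (T : eqType) L (s : seq T) (a b : T -> set X)
    (rank : T -> nat) :
  sorted (fun x y => (rank x <= rank y)%N) s ->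
  (forall x, x \in s -> face (a x) (b x) /\ a x <> b x) ->
  (forall x e, x \in s -> L e -> ~ face (a x) e) ->
  (forall x y, x \in s -> y \in s -> face (a x) (a y) \/ face (a x) (b y) ->
     x = y \/ (rank y < rank x)%N) ->
  uniq s ->
  collapses (L `|` [set e | exists2 x, x \in s & e = a x \/ e = b x]) L.
Proof.
elim: s => [|x s IH] srt ab Lab ord.
  move=> _; have -> : L `|` [set e | exists2 x, x \in [::] & e = a x \/ e = b x] = L.
    by apply/seteqP; split => [e [//|[x]]|e]; [rewrite in_nil|left].
  exact: Relation_Operators.rt_refl.
move=> /= /andP[xs us].
have rk y : y \in s -> (rank x <= rank y)%N.
  have tr : transitive (fun x y : T => (rank x <= rank y)%N).
    by move=> y1 y2 y3; exact: leq_trans.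
  by have /allP := order_path_min tr srt; apply.
have xin : x \in x :: s by rewrite inE eqxx.
have sin y : y \in s -> y \in x :: s by move=> ys; rewrite inE ys orbT.
(* The remaining pairs have rank at least that of [x], so [a x] is a face of none of their cells.
   This is what makes [a x] free, with [b x] as its only proper coface. *)
have nox y : y \in s -> ~ (face (a x) (a y) \/ face (a x) (b y)).
  move=> ys H; case: (ord x y xin (sin y ys) H) => [E|]; last by rewrite ltnNge rk.
  by rewrite E ys in xs.
have [fab nab] := ab x xin.
apply: (@Relation_Operators.rt_trans _ _ _
  (L `|` [set e | exists2 x, x \in s & e = a x \/ e = b x])); last first.
  apply: IH => //.
  - exact: path_sorted srt.
  - by move=> y /sin; exact: ab.
  - by move=> y e /sin; exact: Lab.
  - by move=> y z /sin + /sin; exact: ord.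
apply: Relation_Operators.rt_step; exists (a x), (b x); split.
  split => //.
  - by right; exists x => //; left.
  - by right; exists x => //; right.
  - move=> e [Le /(Lab x e xin Le)//|[y]]; rewrite inE => /orP[/eqP ->//|ys] ey fe.
    by case: (nox y ys); case: ey => <-; [left|right].
apply/seteqP; split => [e [Le|[y ys ey]]|e [[Le|[y yin ey]] nE]].
- split; first by left.
  case=> E; apply: (Lab x e xin Le); rewrite E //; exact: face_refl.
- split; first by right; exists y => //; exact: sin.
  move=> E; apply: (nox y ys).
  have fe : face (a x) e by case: E => ->; [exact: face_refl|].
  by case: ey => <-; [left|right].
- by left.
- move: yin; rewrite inE => /orP[/eqP yx|ys]; last by right; exists y.
  by case: nE; rewrite -yx.
Qed.

End collapsing.

Section collapsing_cells.
Variables (R : realType) (n : nat).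
Local Notation P := (projectivization R n.+1).
Local Notation cell := (@U R n.+1).

(** Membership in the closure of a cell depends only on the sign vector up to sign, so one point of
    [e'] decides for all of [e']. *)
Lemma closure_cell_face (e e' : set P) p : RP_cells R n e -> RP_cells R n e' ->
  e' p -> closure e p -> face e' e.
Proof.
move=> /RP_cellsP[s [ss s0 ->]] /RP_cellsP[t [st t0 ->]].
have [v v0 ->] := linev_surj p; rewrite U_linev // closure_U // face_U //.
case=> ->; first by [].
by case=> H; [right|left]; rewrite -[t]opprK; [|rewrite -[s]opprK]; exact: sign_leN.
Qed.

(** If the closure of a remaining cell met [t] or [s], then [t] would be a face of it, contradicting
    that [t] is free. *)
Lemma elementary_collapse_subcomplex (K L : set (set P)) :
  subcomplex K (RP_cells R n) -> elementary_collapse K L ->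
  subcomplex L (RP_cells R n).
Proof.
move=> [KR Kcl] [t [s [[Kt Ks ts fts free] ->]]]; split=> [e [/KR]//|e [Ke ne] p ep].
have [e' Ke' e'p] := Kcl e Ke p ep.
have fe' := closure_cell_face (KR _ Ke) (KR _ Ke') e'p ep.
exists e' => //; split => // E; apply: ne; apply: free => //.
by case: E fe' => -> // fe; exact: face_trans fts fe.
Qed.

Lemma collapses_deformation (K L : set (set P)) :
  collapses K L -> subcomplex K (RP_cells R n) ->
  subcomplex L (RP_cells R n) /\
  Relation_Operators.clos_refl_sym_trans _ (@deformation_step R)
    (CellComplex K) (CellComplex L).
Proof.
elim=> [{}K {}L KL sK|{}K sK|{}K M {}L _ IH1 _ IH2 sK].
- split; first exact: elementary_collapse_subcomplex sK KL.
  apply: Relation_Operators.rst_step; apply: step_collapse => //.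
  exact: subcomplex_regular_CW.
- by split => //; exact: Relation_Operators.rst_refl.
- have [sM KM] := IH1 sK; have [sL ML] := IH2 sM.
  by split => //; exact: Relation_Operators.rst_trans KM ML.
Qed.

End collapsing_cells.

(** * The matching *)

Section matching.
Variables (n m : nat).
Implicit Types (t w : 'rV[int]_n.+1) (x y : nat * nat * 'rV[int]_n.+1).

(* [t] ends at position [N], alternates on [i+1 .. N] and vanishes at [i]; it is
   matched with the vector in which the entry [i] is a copy of the entry [i+1],
   an operation that does not change the sign variation. *)
Definition matched x : Prop :=
  let: (N, i, t) := x in
  [/\ [/\ sign_vector t, (var t <= m)%N, (m < N <= n)%N & (i < N)%N],
      entry t i = 0, entry t N = 1, (forall j, (N < j)%N -> entry t j = 0)
    & forall j, (i < j < N)%N -> entry t j * entry t j.+1 < 0].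

Definition fill i t : 'rV[int]_n.+1 :=
  \row_(j < n.+1) (if j == i :> nat then entry t i.+1 else entry t j).

Lemma entry_fill i t j : (i <= n)%N ->
  entry (fill i t) j = if j == i then entry t i.+1 else entry t j.
Proof.
move=> i_n; rewrite /fill.
rewrite (entry_row n.+1 (fun j => if j == i then entry t i.+1 else entry t j)).
case: ltnP => // nj; case: eqP => [ji|_]; last by rewrite entry_over.
by move: nj; rewrite ji ltnNge i_n.
Qed.

Lemma entryN t j : entry (- t) j = - entry t j.
Proof.
case: (ltnP j n.+1) => jn; last by rewrite !entry_over // oppr0.
by rewrite -[j]/(nat_of_ord (Ordinal jn)) !entryE mxE.
Qed.

Lemma var_fill i t : (i < n)%N -> (var (fill i t) <= var t)%N.
Proof.
move=> i_n; rewrite !varE; apply: (@seq_var_replicate _ _ _ _ i).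
- by rewrite !size_entries.
- by rewrite size_entries.
- by move=> j ji; rewrite -/(entry _ _) entry_fill ?(ltnW i_n) // (negbTE ji).
- by rewrite -/(entry _ _) entry_fill ?(ltnW i_n) // eqxx.
Qed.

Lemma sign_vector_entry t : sign_vector t ->
  forall j, entry t j \in [:: -1; 0; 1].
Proof.
move=> st j; case: (ltnP j n.+1) => jn; last by rewrite entry_over.
by rewrite -[j]/(nat_of_ord (Ordinal jn)) entryE.
Qed.

Lemma sign_vector_fill i t : sign_vector t -> sign_vector (fill i t).
Proof.
move=> st j; rewrite mxE; case: ifP => _; exact: sign_vector_entry.
Qed.

Lemma sign_le_entry t w : sign_le t w ->
  forall j, entry t j = 0 \/ entry t j = entry w j.
Proof.
move=> tw j; case: (ltnP j n.+1) => jn; last by left; rewrite entry_over.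
by rewrite -[j]/(nat_of_ord (Ordinal jn)) !entryE.
Qed.

(** The lexicographic rank of the triple ([n - N], [i], [n.+1 - #|supp t|]), written in base [n.+2].
    It encodes the order of removal: [N] decreasing, [i] increasing, dimension decreasing. *)
Definition match_rank x : nat :=
  let: (N, i, t) := x in
  (((n - N) * n.+2 + i) * n.+2 + (n.+1 - #|supp t|))%N.

Lemma lex_lt a b c a' b' c' B : (b' < B)%N -> (c' < B)%N ->
  (a' < a)%N || (a' == a) && ((b' < b)%N || (b' == b) && (c' < c)%N) ->
  ((a' * B + b') * B + c' < (a * B + b) * B + c)%N.
Proof.
have key a1 b1 a2 b2 : (a2 < a1)%N -> (b2 < B)%N -> (a2 * B + b2 < a1 * B + b1)%N.
  move=> a12 b2B; apply: (@leq_trans (a2 * B + B)); first by rewrite ltn_add2l.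
  by apply: leq_trans (leq_addr _ _); rewrite -mulSnr leq_mul2r a12 orbT.
move=> bB cB /orP[aa|/andP[/eqP -> /orP[bb|/andP[/eqP -> cc]]]].
- by apply: (key) => //; exact: key.
- by apply: key => //; rewrite ltn_add2l.
- by rewrite ltn_add2l.
Qed.

(** This is the acyclicity of the matching: the lower cell of a pair can be a face of a cell of
    another pair only if that pair is removed earlier. The three components of the rank are compared
    in turn, the next one only when the previous ones agree. *)
Lemma matched_order N i t N' i' t' w :
  matched (N, i, t) -> matched (N', i', t') -> w = t' \/ w = fill i' t' ->
  sign_le t w \/ sign_le t (- w) ->
  (N, i, t) = (N', i', t') \/ (match_rank (N', i', t') < match_rank (N, i, t))%N.
Proof.
move=> [[st _ /andP[_ Nn] iN] ti tN t0 talt].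
move=> [[st' _ /andP[_ Nn'] iN'] ti' tN' t0' talt'] wE tw.
have in' : (i' < n)%N by exact: leq_trans iN' Nn'.
have wt j : j != i' -> entry w j = entry t' j.
  by case: wE => -> // /negbTE ji; rewrite entry_fill ?(ltnW in') // ji.
have wi : entry w i' = 0 \/ entry w i' = entry w i'.+1.
  case: wE => ->; first by left.
  by right; rewrite !entry_fill ?(ltnW in') // eqxx gtn_eqF.
have wN : entry w N' = 1 by rewrite wt // gtn_eqF.
have w0 j : (N' < j)%N -> entry w j = 0.
  by move=> Nj; rewrite wt ?t0' // gtn_eqF // (ltn_trans iN').
have [c c1 {}tw] : exists2 c : int, c = 1 \/ c = -1 &
    forall j, entry t j = 0 \/ entry t j = c * entry w j.
  case: tw => /sign_le_entry tw; [exists 1; first by left|exists (-1); first by right].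
    by move=> j; rewrite mul1r.
  by move=> j; rewrite mulN1r -entryN.
have ci : (i' < n.+2)%N by lia.
have cs : (n.+1 - #|supp t'| < n.+2)%N by lia.
have NN : (N <= N')%N.
  rewrite leqNgt; apply/negP => /w0 wN0.
  by case: (tw N); rewrite tN ?wN0 ?mulr0.
move: NN; rewrite leq_eqVlt => /orP[/eqP NN|NN]; last first.
  by right; apply: lex_lt => //; apply/orP; left; lia.
subst N'.
(* Both vectors end with the entry [1] at the same position, which excludes the opposite sign. *)
have c_1 : c = 1.
  by case: c1 tw => // -> /(_ N); rewrite tN wN => -[].
have {}tw j : entry t j = 0 \/ entry t j = entry w j.
  by have := tw j; rewrite c_1 mul1r.
(* If [i < i'], then [t] alternates between [i'] and [i'.+1] and [w] agrees with it there; but the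
   entry of [w] at [i'] is zero or repeats the next one. *)
have ii : (i' <= i)%N.
  rewrite leqNgt; apply/negP => ii.
  have /talt alt : (i < i' < N)%N by rewrite ii iN'.
  have [t1 t2] : entry t i' != 0 /\ entry t i'.+1 != 0.
    by split; apply: contraTneq alt => ->; rewrite ?mul0r ?mulr0 ltxx.
  case: (tw i') t1 => [->|e1 t1]; first by rewrite eqxx.
  case: (tw i'.+1) t2 => [->|e2 t2]; first by rewrite eqxx.
  move: alt; rewrite e1 e2; case: wi => ->; first by rewrite mul0r ltxx.
  by rewrite ltNge -expr2 sqr_ge0.
move: ii; rewrite leq_eqVlt => /orP[/eqP ii|ii]; last first.
  by right; apply: lex_lt => //; rewrite eqxx ii orbT.
subst i'.
(* Since [t] vanishes at [i], it lies below [t'] even when [w] is the filled vector. *)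
have tt' : sign_le t t'.
  move=> j; rewrite -!entryE; case: (tw j) => [|e]; first by left.
  have [ji|ji] := eqVneq (j : nat) i; first by left; rewrite ji.
  by right; rewrite e wt.
have sub := supp_subset tt'.
have := subset_leq_card sub; rewrite leq_eqVlt => /orP[card_eq|card_lt].
  left; have /setP suppE : supp t = supp t' by apply/eqP; rewrite eqEcard sub (eqP card_eq) /=.
  congr (_, _); apply/rowP => j; case: (tt' j) => // tj0.
  by have := suppE j; rewrite !inE tj0 eqxx => /esym/negbFE/eqP.
right; apply: lex_lt => //; rewrite !eqxx /=.
have := max_card (mem (supp t')); rewrite card_ord => st'n.
apply/orP; right; apply/orP; right; apply: ltn_sub2l => //.
by apply: leq_trans card_lt st'n.
Qed.

Lemma matched_finite : finite_set [set x | matched x].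
Proof.
apply: (@sub_finite_set _ _ (`I_n.+1 `*` `I_n.+1 `*` @sign_vector n.+1)).
  move=> [[N i] t] [[st _ /andP[_ Nn] iN] _ _ _ _]; split => //=; split => //=.
  by rewrite ltnS; apply: leq_trans (ltnW iN) Nn.
apply: finite_setX; last exact: finite_sign_vector.
by apply: finite_setX; exact: finite_II.
Qed.

Lemma matched_cover w : sign_vector w -> (var w <= m)%N ->
  (exists2 j, (m < j)%N & entry w j != 0) ->
  exists N i t, matched (N, i, t) /\
    ((w = t \/ w = - t) \/ (w = fill i t \/ w = - fill i t)).
Proof.
(* The conclusion is symmetric in [w] and [- w], so the last nonzero entry may be taken to be
   [1]. *)
wlog : w / exists2 N, entry w N = 1 & forall j, (N < j)%N -> entry w j = 0.
  move=> H sw vw [j mj wj].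
  have w0 : w != 0.
    apply: contraNneq wj => ->.
    case: (ltnP j n.+1) => jn; last by rewrite entry_over.
    by rewrite -[j]/(nat_of_ord (Ordinal jn)) entryE mxE.
  have [N wN Nmax] := entry_neq0 w0.
  have {}Nmax k : (N < k)%N -> entry w k = 0.
    case: (ltnP k n.+1) => kn; last by rewrite entry_over.
    by rewrite -[k]/(nat_of_ord (Ordinal kn)) entryE; exact: Nmax.
  move: wN; rewrite -entryE => wN.
  have := sign_vector_entry sw N; rewrite !inE (negbTE wN) /= => /orP[] /eqP wN1; last first.
    by apply: H => //; [exists N|exists j].
  have [] := H (- w).
  - exists N; first by rewrite entryN wN1 opprK.
    by move=> k Nk; rewrite entryN Nmax // oppr0.
  - exact: sign_vectorN.
  - by rewrite varN.
  - by exists j => //; rewrite entryN oppr_eq0.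
  move=> N' [i [t [Mt E]]]; exists N', i, t; split => //.
  case: E => [] [] /eqP; rewrite ?eqr_opp ?eqr_oppLR => /eqP ->; tauto.
move=> [N wN Nmax] sw vw [j mj wj].
have mN : (m < N)%N.
  by rewrite ltnNge; apply: contra wj => Nm; rewrite Nmax // (leq_ltn_trans Nm).
have Nn : (N <= n)%N.
  by rewrite -ltnS ltnNge; apply/negP => /entry_over wN0; move: (wN0 _ w); rewrite wN.
pose Q i := (i < N)%N && ~~ (entry w i * entry w i.+1 < 0).
(* Otherwise [w] alternates on all of [0 .. N] and has at least [N > m] sign changes. *)
have Qex : exists i, Q i.
  apply: contrapT => /forallNP nQ.
  have : (N <= var w)%N.
    rewrite varE; apply: seq_var_alternating; first by rewrite size_entries.
    by move=> i iN; have /negP := nQ i; rewrite /Q iN negbK.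
  by rewrite leqNgt (leq_ltn_trans vw).
have Qub i : Q i -> (i <= N)%N by case/andP => /ltnW.
case: (ex_maxnP Qex Qub) => i /andP[iN wi] imax.
have alt k : (i < k < N)%N -> entry w k * entry w k.+1 < 0.
  move=> /andP[ik kN]; apply: contraTT ik => nk; rewrite -leqNgt; apply: imax.
  by rewrite /Q kN.
(* Position [i.+1] is either [N] itself or the start of the alternating tail. *)
have wi1 : entry w i.+1 != 0.
  case: (ltngtP i.+1 N) iN => // [iN _|-> _]; last by rewrite wN.
  have /alt : (i < i.+1 < N)%N by rewrite ltnSn iN.
  by apply: contraTneq => ->; rewrite mul0r ltxx.
have i_n : (i < n)%N by exact: leq_trans Nn.
have in1 : (i <= n)%N by exact: ltnW.
have [wi0|wi0] := eqVneq (entry w i) 0.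
  exists N, i, w; split; last by left; left.
  by split => //; split => //; rewrite mN.
(* Two nonzero signs with nonnegative product are equal. Hence [w] is the upper cell of its pair,
   and erasing the entry [i] gives the lower one. *)
have wii : entry w i = entry w i.+1.
  move: wi wi0 wi1; have := sign_vector_entry sw i; have := sign_vector_entry sw i.+1.
  by rewrite !inE => /or3P[]/eqP -> /or3P[]/eqP ->.
pose t : 'rV[int]_n.+1 := \row_(k < n.+1) (if k == i :> nat then 0 else entry w k).
have tE k : entry t k = if k == i then 0 else entry w k.
  rewrite (entry_row n.+1 (fun k => if k == i then 0 else entry w k)).
  by case: ltnP => // nk; rewrite [entry w k]entry_over // if_same.
exists N, i, t; split; last first.
  right; left; apply: eq_entry => k; rewrite entry_fill // !tE.
  by rewrite [i.+1 == i]gtn_eqF //; case: (k =P i) => [->|].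
have tw : sign_le t w.
  by move=> k; rewrite mxE entryE; case: ifP => _; [left|right].
split.
- split => //; last by rewrite mN.
  + move=> k; rewrite mxE entryE; case: ifP => _; last exact: sw.
    by rewrite !inE eqxx orbT.
  + exact: leq_trans (sign_le_var tw) vw.
- by rewrite tE eqxx.
- by rewrite tE gtn_eqF.
- by move=> k Nk; rewrite tE gtn_eqF ?Nmax // (ltn_trans iN).
- move=> k /andP[ik kN]; rewrite !tE !gtn_eqF ?(ltnW ik) //; last exact: ltnW.
  by apply: alt; rewrite ik.
Qed.

End matching.

(** At most [m.+1] nonzero entries form at most [m] consecutive pairs. *)
Lemma var_le_support (F : realDomainType) n m (w : 'rV[F]_n) :
  (forall j, (m < j)%N -> entry w j = 0) -> (var w <= m)%N.
Proof.
move=> wm; rewrite /var.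
set s := [seq x <- _ | _]; set z := zip _ _.
apply: leq_trans (count_size _ _) _; rewrite size_zip size_behead.
apply: leq_trans (geq_minr _ _) _; rewrite -ltnS.
have : (size s <= m.+1)%N; last by case: (size s).
rewrite /s size_filter -/(entries w).
rewrite -[entries w](cat_take_drop m.+1) count_cat.
have -> : count (fun x => x != 0) (drop m.+1 (entries w)) = 0%N.
  apply/eqP; rewrite -leqn0 leqNgt -has_count; apply/hasPn => x.
  move=> /(nthP 0)[k _ <-]; rewrite nth_drop -/(entry _ _) wm ?eqxx //.
  by rewrite addSn ltnS leq_addr.
by rewrite addn0 (leq_trans (count_size _ _)) // size_take; case: ltnP.
Qed.

(** * The collapse of Gr onto the copy of RP^m *)

Section collapse_Gr.
Variables (R : realType) (n m : nat).
Local Notation P := (projectivization R n.+1).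
Local Notation cell := (@U R n.+1).

(* The copy of [RP m] spanned by the first [m.+1] coordinates. *)
Definition RP_sub_cells : set (set P) :=
  [set U w | w in [set w : 'rV[int]_n.+1 |
    [/\ sign_vector w, w != 0 & forall j, (m < j)%N -> entry w j = 0]]].

Lemma Gr_var_cells_subcomplex : subcomplex (Gr_var_cells R n.+1 m) (RP_cells R n).
Proof.
split=> [e [w [sw w0 _] <-]|e [w [sw w0 vw] <-] p]; first by exists w.
move=> /(closure_U_cells sw)[t [st t0 tw tp]]; exists (cell t) => //.
by exists t => //; split => //; exact: leq_trans (sign_le_var tw) vw.
Qed.

Lemma RP_sub_cells_subcomplex :
  subcomplex RP_sub_cells (Gr_var_cells R n.+1 m).
Proof.
split=> [e [w [sw w0 wm] <-]|e [w [sw w0 wm] <-] p].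
  by exists w => //; split => //; exact: var_le_support wm.
move=> /(closure_U_cells sw)[t [st t0 tw tp]]; exists (cell t) => //.
exists t => //; split => // j mj.
by case: (sign_le_entry tw j) => ->; rewrite ?wm.
Qed.

Lemma Gr_var_collapses : collapses (Gr_var_cells R n.+1 m) RP_sub_cells.
Proof.
have /finite_seqP[s0 s0E] := matched_finite n m.
(* The finitely many pairs are listed in the order in which they are removed. *)
pose s := sort (fun x y => (match_rank x <= match_rank y)%N) (undup s0).
have sP x : x \in s -> matched m x.
  by rewrite mem_sort mem_undup => xs; have : [set` s0] x by []; rewrite -s0E.
have Ps x : matched m x -> x \in s.
  by move=> Mx; rewrite mem_sort mem_undup; have : [set x | matched m x] x by []; rewrite s0E.
pose a (x : nat * nat * 'rV[int]_n.+1) := cell x.2.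
pose b (x : nat * nat * 'rV[int]_n.+1) := cell (fill x.1.2 x.2).
have t0 N i (t : 'rV[int]_n.+1) : matched m (N, i, t) -> t != 0 :> 'rV[int]_n.+1.
  case=> [_ _ tN _ _]; apply: contra_eq_neq tN => ->.
  case: (ltnP N n.+1) => jn; last by rewrite entry_over.
  by rewrite -[N]/(nat_of_ord (Ordinal jn)) entryE mxE.
have leF N i (t : 'rV[int]_n.+1) : matched m (N, i, t) -> sign_le t (fill i t).
  move=> [_ ti _ _ _] j; rewrite mxE entryE; case: eqP => ji; last by right.
  by left; rewrite -entryE ji.
have fi1 N i (t : 'rV[int]_n.+1) : matched m (N, i, t) -> entry t i.+1 != 0.
  case=> [[_ _ _ iN] _ tN _ talt].
  case: (ltngtP i.+1 N) iN => // [iN _|-> _]; last by rewrite tN.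
  have /talt : (i < i.+1 < N)%N by rewrite ltnSn iN.
  by apply: contraTneq => ->; rewrite mul0r ltxx.
have in_n N i (t : 'rV[int]_n.+1) : matched m (N, i, t) -> (i < n)%N.
  by case=> [[_ _ /andP[_ Nn] iN] _ _ _ _]; exact: leq_trans iN Nn.
have f0 N i (t : 'rV[int]_n.+1) : matched m (N, i, t) -> fill i t != 0.
  move=> Mx; apply: contraNneq (fi1 _ _ _ Mx) => f0.
  have := entry_fill t i (ltnW (in_n _ _ _ Mx)); rewrite eqxx f0 => <-.
  have jn : (i < n.+1)%N by exact: ltnW (in_n _ _ _ Mx).
  by rewrite -[i]/(nat_of_ord (Ordinal jn)) entryE mxE.
have -> : Gr_var_cells R n.+1 m = RP_sub_cells `|`
    [set e | exists2 x, x \in s & e = a x \/ e = b x].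
  apply/seteqP; split=> [e [w [sw w0 vw] <-]|e [|[[[N i] t] /sP Mx ex]]].
  - have [wm|/existsNP[j /not_implyP[mj /eqP wj]]] :=
      pselect (forall j, (m < j)%N -> entry w j = 0); first by left; exists w.
    have [N [i [t [Mx E]]]] := matched_cover sw vw (ex_intro2 _ _ j mj wj).
    right; exists (N, i, t); first exact: Ps.
    by case: E => [] [] ->; rewrite ?U_opp; [left|left|right|right].
  - by apply: RP_sub_cells_subcomplex.1.
  - have [[st vt mN iN] ti tN _ _] := Mx.
    case: ex => ->; first by exists t => //; split => //; exact: t0 Mx.
    exists (fill i t) => //; split; [exact: sign_vector_fill|exact: f0 Mx|].
    exact: leq_trans (var_fill _ (in_n _ _ _ Mx)) vt.
apply: (@collapses_pairs _ _ _ _ _ _ (@match_rank n)).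
- by apply: sort_sorted => x y; exact: leq_total.
- move=> [[N i] t] /sP Mx; have [[st vt mN iN] ti tN _ _] := Mx.
  have sf := sign_vector_fill i st; rewrite /a /b /=; split.
    by apply/face_U => //; [exact: t0 Mx|left; exact: leF Mx].
  (* Equal cells would have sign vectors equal up to sign, but [t] vanishes at [i] and [fill i t]
     does not. *)
  move=> /(U_inj st (t0 _ _ _ Mx)) E.
  have := entry_fill t i (ltnW (in_n _ _ _ Mx)); rewrite eqxx => fE.
  have := fi1 _ _ _ Mx; rewrite -fE.
  suff -> : entry (fill i t) i = 0 by rewrite eqxx.
  case: E => E; first by rewrite -E.
  by apply/eqP; rewrite -oppr_eq0 -entryN -E ti.
(* A cell of the target vanishes at [N > m], where [t] has the entry [1]. *)
- move=> [[N i] t] e /sP Mx [w [sw w0 wm] <-].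
  have [[st vt /andP[mN _] iN] ti tN _ _] := Mx.
  rewrite /a /= face_U //; last exact: t0 Mx.
  by case=> /sign_le_entry/(_ N); rewrite ?entryN tN wm ?oppr0 // => -[].
- move=> [[N i] t] [[N' i'] t'] /sP Mx /sP My.
  have [[st _ _ _] _ _ _ _] := Mx; have [[st' _ _ _] _ _ _ _] := My.
  have sf := sign_vector_fill i' st'; have tn0 := t0 _ _ _ Mx.
  rewrite /a /b /= !face_U // => H.
  case: H => H; apply: (matched_order Mx My _ H); by [left|right].
- by rewrite sort_uniq undup_uniq.
Qed.

End collapse_Gr.

(** * Maps between projectivizations *)

Section projective_maps.
Variables (R : realType) (n k : nat).
Local Notation vec := 'rV[R]_n.+1.

(** Homogeneity turns the unknown factor of the chosen representative into a scalar, which [linev]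
    forgets. *)
Lemma linev_rep_homogeneous (f : vec -> 'rV[R]_k.+1) v :
  (forall c u, f (c *: u) = c *: f u) -> v != 0 ->
  linev (f (rep (linev v))) = linev (f v).
Proof.
by move=> fZ v0; have [c c0 ->] := rep_linev v0; rewrite fZ linevZ.
Qed.

(** Continuity is tested pointwise, so [f] must be nonzero only on lines in the image of [i]. This
    matters for the flow, whose nonvanishing is known only where the variation is at most [m]. *)
Lemma continuous_linev_homotopy (X T : topologicalType)
    (i : X -> projectivization R n.+1) (f : vec -> T -> 'rV[R]_k.+1) :
  continuous i -> (forall t c u, f (c *: u) t = c *: f u t) ->
  continuous (fun x : vec * T => f x.1 x.2) ->
  (forall x v t, v != 0 -> i x = linev v -> f v t != 0) ->
  continuous (fun x : X * T => linev (f (rep (i x.1)) x.2)).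
Proof.
move=> ci fZ cf f0 [x t].
have [v v0 xv] := linev_surj (i x).
pose F (y : projectivization R n.+1 * T) := linev (f (rep y.1) y.2).
have Fc : {for (i x, t), continuous F}.
  rewrite xv; apply: (@continuous_linev_prod _ _ _ _ _ (fun y => linev (f y.1 y.2))) => //.
    by move=> u s u0; apply: (@linev_rep_homogeneous (fun u => f u s)).
  apply: (@continuous_comp _ _ _ (fun y : vec * T => f y.1 y.2)); first exact: cf.
  by apply: linev_continuous; exact: f0 xv.
apply: (@continuous_comp _ _ _ (fun y : X * T => (i y.1, y.2)) F); last exact: Fc.
have c1 : {for (x, t), continuous (fun y : X * T => i y.1)}.
  by apply: (@continuous_comp _ _ _ fst i); [exact: cvg_fst|exact: ci].
have c2 : {for (x, t), continuous (fun y : X * T => y.2)} by exact: cvg_snd.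
exact: (cvg_pair c1 c2).
Qed.

Lemma continuous_linev_rep (X : topologicalType)
    (i : X -> projectivization R n.+1) (f : vec -> 'rV[R]_k.+1) :
  continuous i -> (forall c u, f (c *: u) = c *: f u) -> continuous f ->
  (forall x v, v != 0 -> i x = linev v -> f v != 0) ->
  continuous (fun x : X => linev (f (rep (i x)))).
Proof.
move=> ci fZ cf f0 x.
have c2 : continuous (fun y : vec * R => f y.1).
  by move=> y; apply: (@continuous_comp _ _ _ fst f); [exact: cvg_fst|exact: cf].
have H := @continuous_linev_homotopy X R i (fun u _ => f u) ci (fun _ => fZ) c2
  (fun x v _ => f0 x v).
apply: (@continuous_comp _ _ _ (fun y : X => (y, 0 : R)) _ x _ (H (x, 0))).
have c1 : {for x, continuous (fun y : X => y)} by exact: cvg_id.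
have c0 : {for x, continuous (fun y : X => 0 : R)} by exact: cvg_cst.
exact: (cvg_pair c1 c0).
Qed.

End projective_maps.

Section resize.
Variables (F : realDomainType) (p q : nat).

(* Truncation, or extension by zeros, to [q] coordinates. *)
Definition resize (v : 'rV[F]_p) : 'rV[F]_q := \row_(i < q) entry v i.

Lemma entry_resize v i : entry (resize v) i = if (i < q)%N then entry v i else 0.
Proof. exact: entry_row. Qed.

Lemma entryZ n c (v : 'rV[F]_n) i : entry (c *: v) i = c * entry v i.
Proof.
case: (ltnP i n) => jn; last by rewrite !entry_over // mulr0.
by rewrite -[i]/(nat_of_ord (Ordinal jn)) !entryE mxE.
Qed.

Lemma resizeZ c v : resize (c *: v) = c *: resize v.
Proof. by apply/rowP => i; rewrite !mxE entryZ. Qed.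

Lemma entry0 n i : entry (0 : 'rV[F]_n) i = 0.
Proof.
case: (ltnP i n) => jn; last by rewrite entry_over.
by rewrite -[i]/(nat_of_ord (Ordinal jn)) entryE mxE.
Qed.

Lemma entry_ex n (v : 'rV[F]_n) : v != 0 -> exists i, entry v i != 0.
Proof. by case/entry_neq0 => i vi _; exists i; rewrite entryE. Qed.

End resize.

Arguments resize {F p} q v.

Lemma resizeK (F : realDomainType) p q (v : 'rV[F]_p) :
  (forall j, (q <= j)%N -> entry v j = 0) -> resize p (resize q v) = v.
Proof.
move=> v0; apply: eq_entry => i; rewrite !entry_resize.
case: ltnP => ip; last by rewrite entry_over.
by case: ltnP => // qi; rewrite v0.
Qed.

Lemma resize_neq0 (F : realDomainType) p q (v : 'rV[F]_p) :
  (forall j, (q <= j)%N -> entry v j = 0) -> v != 0 -> resize q v != 0.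
Proof.
move=> v0; apply: contra_neq => rv; rewrite -(resizeK v0) rv.
by apply/rowP => i; rewrite !mxE entry0.
Qed.

Lemma entry_sgn (F : realDomainType) n (v : 'rV[F]_n) i :
  entry (sgn v) i = sgz (entry v i).
Proof.
case: (ltnP i n) => jn; last by rewrite !entry_over // sgz0.
by rewrite -[i]/(nat_of_ord (Ordinal jn)) !entryE mxE.
Qed.

Lemma sgn_resize (F : realDomainType) p q (v : 'rV[F]_p) :
  sgn (resize q v) = resize q (sgn v).
Proof. by apply/rowP => i; rewrite !mxE entry_sgn. Qed.

Lemma entry_continuous (R : realType) n i :
  continuous (fun v : 'rV[R]_n => entry v i).
Proof.
case: (ltnP i n) => jn; last first.
  have -> : (fun v : 'rV[R]_n => entry v i) = cst 0.
    by apply/funext => v; rewrite entry_over.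
  exact: cst_continuous.
have -> : (fun v : 'rV[R]_n => entry v i) = (fun v => v 0 (Ordinal jn)).
  by apply/funext => v; rewrite -entryE.
exact: coord_continuous.
Qed.

Lemma resize_continuous (R : realType) p q : continuous (@resize R p q).
Proof.
apply: continuous_row => i; have -> : (fun v => (resize q v : 'rV[R]_q) 0 i) =
    (fun v : 'rV[R]_p => entry v i) by apply/funext => v; rewrite mxE.
exact: entry_continuous.
Qed.

(** * Identification of the target subcomplex with RP^m *)

Section RP_sub.
Variables (R : realType) (n m : nat) (mn : (m <= n)%N).
Local Notation P := (projectivization R n.+1).
Local Notation RPsub := (@RP_sub_cells R n m).
Local Notation Y := (set_type (realization RPsub)).

Lemma entry_RP (x : 'rV[R]_m.+1) j : (n.+1 <= j)%N -> entry x j = 0.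
Proof. by move=> nj; rewrite entry_over //; apply: leq_trans nj. Qed.

Lemma realization_RP_sub (v : 'rV[R]_n.+1) : v != 0 ->
  realization RPsub (linev v) <-> forall j, (m < j)%N -> entry v j = 0.
Proof.
move=> v0; split.
  case=> _ [w [sw w0 wm] <-] /U_linev-/(_ v0) vw j mj.
  apply/eqP; rewrite -sgz_eq0 -entry_sgn; case: vw => ->; rewrite ?entryN wm //.
move=> vm; exists (@U R _ (sgn v)); last by apply/U_linev => //; left.
exists (sgn v) => //; split; [exact: sign_vector_sgn|by rewrite sgn_eq0|].
by move=> j mj; rewrite entry_sgn vm // sgz0.
Qed.

Lemma entry_resize_RP (x : 'rV[R]_m.+1) j : (m < j)%N -> entry (resize n.+1 x) j = 0.
Proof. by move=> mj; rewrite entry_resize (@entry_over _ _ x) ?if_same. Qed.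

Definition RP_sub_to (p : Y) : RP R m := linev (resize m.+1 (rep (set_val p))).

Lemma RP_sub_of_subproof (q : RP R m) :
  realization RPsub (linev (resize n.+1 (rep q))).
Proof.
apply/realization_RP_sub; last by move=> j; exact: entry_resize_RP.
by apply: resize_neq0 (rep_neq0 _) => j; exact: entry_RP.
Qed.

Definition RP_sub_of (q : RP R m) : Y := in_set_type (RP_sub_of_subproof q).

Lemma RP_sub_ofE q : set_val (RP_sub_of q) = linev (resize n.+1 (rep q)).
Proof. exact: in_set_typeK. Qed.

Lemma RP_sub_rep (p : Y) (v : 'rV[R]_n.+1) : v != 0 -> set_val p = linev v ->
  forall j, (m < j)%N -> entry v j = 0.
Proof.
move=> v0 pv; apply/(realization_RP_sub v0); rewrite -pv.
exact: (set_valP p).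
Qed.

Lemma RP_sub_to_continuous : continuous RP_sub_to.
Proof.
apply: continuous_linev_rep.
- exact: continuous_set_val.
- exact: resizeZ.
- exact: resize_continuous.
- by move=> p v v0 /(RP_sub_rep v0) vm; exact: resize_neq0.
Qed.

Lemma RP_sub_of_continuous : continuous RP_sub_of.
Proof.
apply: continuous_into_set_type.
have -> : set_val \o RP_sub_of = (fun q : RP R m => linev (resize n.+1 (rep q))).
  by apply/funext => q; exact: RP_sub_ofE.
apply: (@continuous_linev_rep _ _ _ _ id).
- by move=> x; exact: cvg_id.
- exact: resizeZ.
- exact: resize_continuous.
- by move=> _ v v0 _; apply: resize_neq0 v0 => j; exact: entry_RP.
Qed.

Lemma RP_sub_toK : cancel RP_sub_to RP_sub_of.
Proof.
move=> p; apply: set_val_inj; rewrite RP_sub_ofE /RP_sub_to.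
have [v v0 pv] := linev_surj (set_val p); rewrite pv.
have vm := RP_sub_rep v0 pv; have rv0 := resize_neq0 vm v0.
rewrite (linev_rep_homogeneous _ v0); last exact: resizeZ.
by rewrite (linev_rep_homogeneous _ rv0) ?resizeK //; exact: resizeZ.
Qed.

Lemma RP_sub_ofK : cancel RP_sub_of RP_sub_to.
Proof.
move=> q; rewrite /RP_sub_to RP_sub_ofE.
have [x x0 ->] := linev_surj q.
have xn j : (n.+1 <= j)%N -> entry x j = 0 by exact: entry_RP.
have rx0 := resize_neq0 xn x0.
rewrite (linev_rep_homogeneous _ x0); last exact: resizeZ.
by rewrite (linev_rep_homogeneous _ rx0) ?resizeK //; exact: resizeZ.
Qed.

Lemma RP_sub_homeomorphic : homeomorphic Y (RP R m).
Proof.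
exists RP_sub_to, RP_sub_of; split.
- exact: RP_sub_to_continuous.
- exact: RP_sub_of_continuous.
- exact: RP_sub_toK.
- exact: RP_sub_ofK.
Qed.

Lemma realization_RP_cells k p : realization (RP_cells R k) p.
Proof.
have [v v0 ->] := linev_surj p.
exists (@U R _ (sgn v)); last by apply/U_linev => //; left.
by exists (sgn v) => //; split; [exact: sign_vector_sgn|rewrite sgn_eq0].
Qed.

Lemma RP_cells_subcomplex k : subcomplex (RP_cells R k) (RP_cells R k).
Proof. by split => // e _ p _; exact: realization_RP_cells. Qed.

Lemma RP_sub_cellular_isomorphism : cellular_isomorphism RPsub (RP_cells R m).
Proof.
(* The cells of [RP_cells] cover the whole space, so the homeomorphism need only be wrapped into the
   subspace of all points. *)
exists (fun p => in_set_type (@realization_RP_cells m (RP_sub_to p))).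
exists (RP_sub_of \o set_val); split.
- apply: continuous_into_set_type; rewrite (_ : _ \o _ = RP_sub_to).
    exact: RP_sub_to_continuous.
  by apply/funext => p; exact: in_set_typeK.
- move=> q; apply: continuous_comp; first exact: continuous_set_val.
  exact: RP_sub_of_continuous.
- by move=> p; rewrite [LHS](congr1 RP_sub_of (in_set_typeK _)) RP_sub_toK.
- by move=> q; apply: set_val_inj; rewrite in_set_typeK RP_sub_ofK.
(* Truncation commutes with taking signs, so it carries cells to cells. *)
have img w : (forall j, (m < j)%N -> entry w j = 0) ->
    cell_image (fun p => in_set_type (@realization_RP_cells m (RP_sub_to p)))
      (@U R n.+1 w) = @U R m.+1 (resize m.+1 w).
  move=> wm; apply/seteqP; split.
    move=> _ [p wp <-]; rewrite in_set_typeK /RP_sub_to.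
    have {}wp : U w (set_val p) by exact: wp.
    have [v v0 pv] := linev_surj (set_val p); rewrite pv in wp *.
    have vm := RP_sub_rep v0 pv; have rv0 := resize_neq0 vm v0.
    rewrite (linev_rep_homogeneous _ v0); last exact: resizeZ.
    apply/U_linev => //; rewrite sgn_resize; move/U_linev: wp => /(_ v0)[]->; first by left.
    by right; rewrite -!scaleN1r resizeZ.
  move=> q; have [x x0 ->] := linev_surj q => /U_linev-/(_ x0) xw.
  have xn j : (n.+1 <= j)%N -> entry x j = 0 by exact: entry_RP.
  have rx0 := resize_neq0 xn x0.
  exists (RP_sub_of (linev x)); last by rewrite in_set_typeK RP_sub_ofK.
  suff : U w (set_val (RP_sub_of (linev x))) by [].
  rewrite RP_sub_ofE (linev_rep_homogeneous _ x0); last exact: resizeZ.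
  apply/U_linev => //; rewrite sgn_resize; case: xw => ->.
    by left; rewrite resizeK.
  by right; rewrite -scaleN1r resizeZ resizeK // scaleN1r.
apply/seteqP; split=> [_ [_ [w [sw w0 wm] <-] <-]|_ [u [su u0] <-]].
  rewrite img //; exists (resize m.+1 w) => //; split; last exact: resize_neq0.
  by move=> i; rewrite mxE; exact: sign_vector_entry.
have un j : (n.+1 <= j)%N -> entry u j = 0.
  by move=> nj; rewrite entry_over //; apply: leq_trans nj.
have um j : (m < j)%N -> entry (resize n.+1 u) j = 0.
  by move=> mj; rewrite entry_resize (@entry_over _ _ u) ?if_same.
exists (@U R n.+1 (resize n.+1 u)); last by rewrite img // resizeK.
exists (resize n.+1 u) => //; split => //; last exact: resize_neq0.
by move=> i; rewrite mxE; exact: sign_vector_entry.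
Qed.

End RP_sub.

(** * The homotopy equivalence *)

Section shear.
Variables (F : realDomainType) (n m : nat).
Implicit Types (v : 'rV[F]_n) (t : F).

Definition shear t v : 'rV[F]_n := \row_(j < n) (entry v j + t * entry v j.+1).

Definition damp t v : 'rV[F]_n :=
  \row_(j < n) (if (j <= m)%N then entry v j else (1 - t) * entry v j).

(** One parameter drives both operations. The number [n] of shears is the length of [v], which
    suffices for [leading_zeros_iter_shear] at [t = 1]. *)
Definition squeeze v t : 'rV[F]_n := damp t (iter n (shear t) v).

Lemma entry_shear t v j : entry (shear t v) j = entry v j + t * entry v j.+1.
Proof.
rewrite /shear (entry_row n (fun j => entry v j + t * entry v j.+1)).
by case: ltnP => // nj; rewrite !entry_over ?mulr0 ?addr0 // leqW.
Qed.

Lemma entries_shear t v : entries (shear t v) = shear_seq t (entries v).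
Proof.
apply: (@eq_from_nth _ 0); first by rewrite size_shear !size_entries.
by move=> j _; rewrite nth_shear -!/(entry _ _) entry_shear.
Qed.

Lemma entries_iter_shear t v k :
  entries (iter k (shear t) v) = iter k (shear_seq t) (entries v).
Proof. by elim: k => //= k IH; rewrite entries_shear IH. Qed.

Lemma iter_shear_neq0 t v k : v != 0 -> iter k (shear t) v != 0.
Proof.
move=> v0; elim: k => //= k; rewrite -!has_entries entries_shear.
exact: has_shear.
Qed.

Lemma var_iter_shear t v k : 0 <= t -> (var (iter k (shear t) v) <= var v)%N.
Proof.
move=> t0; elim: k => //= k IH; apply: leq_trans IH.
by rewrite !varE entries_shear seq_var_shear.
Qed.

Lemma entry_damp t v j :
  entry (damp t v) j = if (j <= m)%N then entry v j else (1 - t) * entry v j.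
Proof.
rewrite /damp (entry_row n (fun j => if (j <= m)%N then entry v j
  else (1 - t) * entry v j)).
by case: ltnP => // nj; rewrite !entry_over // mulr0 if_same.
Qed.

Lemma var_squeeze v t : 0 <= t <= 1 -> (var (squeeze v t) <= var v)%N.
Proof.
move=> /andP[t0 t1]; apply: leq_trans (var_iter_shear v n t0).
apply: var_face => i; rewrite -!entryE entry_damp; case: ifP => _; first by right.
move: t1; rewrite le_eqVlt => /orP[/eqP ->|t1]; first by left; rewrite subrr mul0r.
by right; rewrite sgzM gtr0_sgz ?mul1r // subr_gt0.
Qed.

(** For [t < 1] the shears preserve nonvanishing and the damping factors are nonzero. For [t = 1]
    the first nonzero entry after the shears sits at a position at most [m], which damping leaves
    alone. *)
Lemma squeeze_neq0 v t : 0 <= t <= 1 -> v != 0 -> (var v <= m)%N ->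
  squeeze v t != 0.
Proof.
move=> /andP[t0 t1] v0 vm.
suff [j] : exists j, entry (squeeze v t) j != 0.
  by apply: contra_neq => ->; rewrite entry0.
move: t1; rewrite le_eqVlt => /orP[/eqP t1|t1]; last first.
  have [j vj] := entry_ex (iter_shear_neq0 t n v0); exists j.
  rewrite entry_damp; case: ifP => // _; rewrite mulf_neq0 //.
  by rewrite subr_eq0 gt_eqF.
set u := iter n (shear t) v.
have u0 : u != 0 by exact: iter_shear_neq0.
have hu : has (fun x => x != 0) (entries u) by rewrite has_entries.
exists (leading_zeros (entries u)); rewrite entry_damp.
have -> : (leading_zeros (entries u) <= m)%N.
  rewrite /u t1 entries_iter_shear; apply: leading_zeros_iter_shear.
  - by rewrite size_entries.
  - by rewrite has_entries.
  - by rewrite -varE.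
exact: (nth_find 0 hu).
Qed.

Lemma squeeze0 v : squeeze v 0 = v.
Proof.
have s0 u : shear 0 u = u.
  by apply: eq_entry => j; rewrite entry_shear mul0r addr0.
have -> : squeeze v 0 = damp 0 v.
  by rewrite /squeeze; congr damp; elim: (n in iter n) => //= k ->.
by apply: eq_entry => j; rewrite entry_damp subr0 mul1r if_same.
Qed.

Lemma entry_squeeze1 v j : (m < j)%N -> entry (squeeze v 1) j = 0.
Proof. by move=> mj; rewrite entry_damp leqNgt mj /= subrr mul0r. Qed.

(** A shear moves entries only towards smaller indices. Hence the flow preserves the copy of RP^m
    and yields a homotopy there as well. *)
Lemma entry_squeeze_support v t : (forall j, (m < j)%N -> entry v j = 0) ->
  forall j, (m < j)%N -> entry (squeeze v t) j = 0.
Proof.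
move=> vm j mj; rewrite entry_damp leqNgt mj /=.
suff -> : entry (iter n (shear t) v) j = 0 by rewrite mulr0.
elim: (n in iter n) j mj => [|k IH] j mj /=; first exact: vm.
by rewrite entry_shear !IH ?mulr0 ?addr0 // leqW.
Qed.

Lemma squeezeZ t c v : squeeze (c *: v) t = c *: squeeze v t.
Proof.
have sZ u : shear t (c *: u) = c *: shear t u.
  by apply: eq_entry => j; rewrite entryZ !entry_shear !entryZ mulrDr mulrCA.
have itZ : iter n (shear t) (c *: v) = c *: iter n (shear t) v.
  by elim: (n in iter n) => //= k ->.
apply: eq_entry => j; rewrite /squeeze itZ entryZ !entry_damp entryZ.
by case: ifP => // _; rewrite mulrCA.
Qed.

End shear.

Section shear_continuity.
Variables (R : realType) (n m : nat).

Lemma entry_comp_continuous (T : topologicalType) (f : T -> 'rV[R]_n) j :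
  continuous f -> continuous (fun x => entry (f x) j).
Proof.
move=> cf x; apply: (@continuous_comp _ _ _ f (fun v => entry v j)); first exact: cf.
exact: entry_continuous.
Qed.

Lemma squeeze_continuous :
  continuous (fun x : 'rV[R]_n * R => squeeze m x.1 x.2).
Proof.
have ct : continuous (fun x : 'rV[R]_n * R => x.2) by move=> x; exact: cvg_snd.
have ci k : continuous (fun x : 'rV[R]_n * R => iter k (shear x.2) x.1).
  elim: k => [|k IH] /=; first by move=> x; exact: cvg_fst.
  apply: continuous_row => j; under eq_fun do rewrite mxE.
  move=> x.
  have c1 := @entry_comp_continuous _ _ j IH.
  have c2 := @entry_comp_continuous _ _ j.+1 IH.
  exact: (continuousD (c1 x) (continuousM (ct x) (c2 x))).
have cn j := @entry_comp_continuous _ _ j (ci n).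
apply: continuous_row => j; rewrite /squeeze; under eq_fun do rewrite mxE.
case: (leqP j m) => _; first exact: cn.
move=> x; have c1 : continuous (fun _ : 'rV[R]_n * R => 1 : R) by exact: cst_continuous.
exact: (continuousM (continuousB (c1 x) (ct x)) (cn j x)).
Qed.

End shear_continuity.

Section homotopy.
Variables (R : realType) (n m : nat) (mn : (m <= n)%N).
Local Notation vec := 'rV[R]_n.+1.
Local Notation P := (projectivization R n.+1).
Local Notation Gr := (Gr_var R n.+1 m).
Local Notation X := (set_type Gr).

Lemma varZ (c : R) (v : vec) : c != 0 -> var (c *: v) = var v.
Proof.
move=> c0; rewrite -var_sgn sgnZ; case: (sgzP c) c0 => // _ _.
  by rewrite scale1r var_sgn.
by rewrite scaleN1r varN var_sgn.
Qed.

Lemma Gr_var_linev (v : vec) : v != 0 -> Gr (linev v) <-> (var v <= m)%N.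
Proof.
move=> v0; split=> [[x /= xm]|vm]; last by exists (nzv v0); [rewrite /= nzvK|rewrite -linevE].
rewrite line_linev => /linev_eq[]//; first by have := set_valP x.
by move=> c c0 ->; rewrite varZ.
Qed.

Lemma realization_Gr_var_cells : realization (Gr_var_cells R n.+1 m) = Gr.
Proof.
apply/seteqP; split=> p; have [v v0 ->] := linev_surj p.
  case=> _ [w [sw w0 vw] <-] /U_linev-/(_ v0) E; apply/Gr_var_linev => //.
  by rewrite -var_sgn; case: E => ->; rewrite ?varN.
move=> /Gr_var_linev-/(_ v0) vm; exists (@U R _ (sgn v)); last by apply/U_linev => //; left.
exists (sgn v) => //; split; [exact: sign_vector_sgn|by rewrite sgn_eq0|].
by rewrite var_sgn.
Qed.

Lemma Gr_rep (p : X) (v : vec) : v != 0 -> set_val p = linev v -> (var v <= m)%N.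
Proof.
by move=> v0 pv; apply/(Gr_var_linev v0); rewrite -pv; exact: (set_valP p).
Qed.

(* Time runs backwards, and is frozen outside of the unit interval. *)
Definition clock (t : R) : R := Num.max 0 (Num.min 1 (1 - t)).

Lemma clock_itv t : 0 <= clock t <= 1.
Proof. by rewrite /clock le_max lexx /= ge_max ler01 /= ge_min lexx. Qed.

Lemma clock0 : clock 0 = 1.
Proof. by rewrite /clock subr0 minxx; apply/max_idPr. Qed.

Lemma clock1 : clock 1 = 0.
Proof. by rewrite /clock subrr min_r ?ler01 // maxxx. Qed.

Lemma clock_continuous : continuous clock.
Proof.
have cc (a : R) : continuous (fun _ : R => a) by exact: cst_continuous.
have ci : continuous (fun t : R => t) by move=> s; exact: cvg_id.
move=> t.
exact: (continuous_max (cc 0 t) (continuous_min (cc 1 t) (continuousB (cc 1 t) (ci t)))).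
Qed.

Lemma squeeze_clock_continuous :
  continuous (fun x : vec * R => squeeze m x.1 (clock x.2)).
Proof.
move=> [v t]; apply: (@continuous_comp _ _ _ (fun x : vec * R => (x.1, clock x.2))
  (fun x => squeeze m x.1 x.2)); last exact: squeeze_continuous.
have c1 : {for (v, t), continuous (fun y : vec * R => y.1)} by exact: cvg_fst.
have c2 : {for (v, t), continuous (fun y : vec * R => clock y.2)}.
  by apply: (@continuous_comp _ _ _ snd clock); [exact: cvg_snd|exact: clock_continuous].
exact: (cvg_pair c1 c2).
Qed.

Definition Gr_to (p : X) : RP R m :=
  linev (resize m.+1 (squeeze m (rep (set_val p)) 1)).

Lemma Gr_of_subproof (q : RP R m) : Gr (linev (resize n.+1 (rep q))).
Proof.
apply/Gr_var_linev.
  by apply: resize_neq0 (rep_neq0 _) => j; exact: entry_RP.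
by apply: var_le_support => j; exact: entry_resize_RP.
Qed.

Definition Gr_of (q : RP R m) : X := in_set_type (Gr_of_subproof q).

Lemma Gr_flow_subproof (x : X * R) :
  Gr (linev (squeeze m (rep (set_val x.1)) (clock x.2))).
Proof.
have r0 := rep_neq0 (set_val x.1).
have rm : (var (rep (set_val x.1)) <= m)%N by apply: (@Gr_rep x.1); rewrite ?repK.
apply/Gr_var_linev; first by apply: squeeze_neq0 => //; exact: clock_itv.
by apply: leq_trans rm; apply: var_squeeze; exact: clock_itv.
Qed.

Definition Gr_flow (x : X * R) : X := in_set_type (Gr_flow_subproof x).

Lemma itv01 : 0 <= (1 : R) <= 1. Proof. by rewrite ler01 lexx. Qed.

(** [Gr_to] follows the flow to its end and truncates; [Gr_of] extends by zeros. Both homotopies are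
    the flow run backwards. *)
Lemma Gr_var_homotopy_equivalent : homotopy_equivalent R X (RP R m).
Proof.
have Gr_ofE q : set_val (Gr_of q) = linev (resize n.+1 (rep q)).
  exact: in_set_typeK.
have sZ t c (u : vec) : squeeze m (c *: u) t = c *: squeeze m u t by exact: squeezeZ.
have rsZ t c (u : vec) :
    resize m.+1 (squeeze m (c *: u) t) = c *: resize m.+1 (squeeze m u t).
  by rewrite sZ resizeZ.
have xn (x : 'rV[R]_m.+1) j : (n.+1 <= j)%N -> entry x j = 0 by exact: entry_RP.
have xm (x : 'rV[R]_m.+1) : (var (resize n.+1 x) <= m)%N.
  by apply: var_le_support => j; exact: entry_resize_RP.
have rs0 t (x : 'rV[R]_m.+1) : 0 <= t <= 1 -> x != 0 ->
    resize m.+1 (squeeze m (resize n.+1 x) t) != 0.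
  move=> t01 x0; apply: resize_neq0.
    by apply: entry_squeeze_support => j; exact: entry_resize_RP.
  by apply: squeeze_neq0 => //; exact: (resize_neq0 (xn x) x0).
exists Gr_to, Gr_of; split.
- apply: (@continuous_linev_rep _ _ _ _ set_val (fun v => resize m.+1 (squeeze m v 1))).
  + exact: continuous_set_val.
  + exact: rsZ.
  + move=> v; apply: (@continuous_comp _ _ _ (fun v : vec => squeeze m v 1));
      last exact: resize_continuous.
    apply: (@continuous_comp _ _ _ (fun v : vec => (v, 1 : R))
      (fun x => squeeze m x.1 x.2)); last exact: squeeze_continuous.
    have c1 : {for v, continuous (fun u : vec => u)} by move=> A H; exact: H.
    have c2 : continuous (fun _ : vec => 1 : R) by exact: cst_continuous.
    exact: (cvg_pair c1 (c2 v)).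
  + move=> p v v0 /(Gr_rep v0) vm; apply: resize_neq0.
      by move=> j; exact: entry_squeeze1.
    by apply: squeeze_neq0 => //; exact: itv01.
- apply: continuous_into_set_type.
  have -> : set_val \o Gr_of = (fun q : RP R m => linev (resize n.+1 (rep q))).
    by apply/funext => q; exact: Gr_ofE.
  apply: (@continuous_linev_rep _ _ _ _ id).
  + by move=> x; exact: cvg_id.
  + exact: resizeZ.
  + exact: resize_continuous.
  + by move=> _ v v0 _; apply: resize_neq0 v0 => j; exact: entry_RP.
(* At time [0] the flow has reached its end, where truncating and extending again changes nothing;
   at time [1] it is the identity. *)
- exists Gr_flow; split.
  + apply: continuous_subspaceT; apply: continuous_into_set_type.
    have -> : set_val \o Gr_flow =
        (fun x : X * R => linev (squeeze m (rep (set_val x.1)) (clock x.2))).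
      by apply/funext => x; exact: in_set_typeK.
    apply: (@continuous_linev_homotopy _ _ _ _ _ set_val (fun v t => squeeze m v (clock t))).
    * exact: continuous_set_val.
    * by move=> t; exact: sZ.
    * exact: squeeze_clock_continuous.
    * move=> p v t v0 /(Gr_rep v0) vm; apply: squeeze_neq0 => //; exact: clock_itv.
  + move=> p; apply: set_val_inj; rewrite in_set_typeK Gr_ofE clock0 /Gr_to.
    have [v v0 pv] := linev_surj (set_val p); rewrite pv.
    have vm := Gr_rep v0 pv; have s0 := squeeze_neq0 itv01 v0 vm.
    have e1 j : (m.+1 <= j)%N -> entry (squeeze m v 1) j = 0 by exact: entry_squeeze1.
    rewrite (@linev_rep_homogeneous _ _ _ (fun v => squeeze m v 1)) //.
    rewrite (@linev_rep_homogeneous _ _ _ (fun v => resize m.+1 (squeeze m v 1))) //.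
    rewrite linev_rep_homogeneous ?resizeK //; first exact: resizeZ.
    exact: resize_neq0.
  + by move=> p; apply: set_val_inj; rewrite in_set_typeK clock1 squeeze0 repK.
(* On [RP m] the flow is applied after extension by zeros. It stays supported on the first [m.+1]
   coordinates, so the final truncation does not produce zero. *)
- exists (fun x => linev (resize m.+1 (squeeze m (resize n.+1 (rep x.1)) (clock x.2)))).
  have hZ t c (u : 'rV[R]_m.+1) : resize m.+1 (squeeze m (resize n.+1 (c *: u)) t) =
      c *: resize m.+1 (squeeze m (resize n.+1 u) t).
    by rewrite resizeZ rsZ.
  split.
  + apply: continuous_subspaceT.
    apply: (@continuous_linev_homotopy _ _ _ _ _ id
      (fun v t => resize m.+1 (squeeze m (resize n.+1 v) (clock t)))).
    * by move=> x; exact: cvg_id.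
    * by move=> t; exact: hZ.
    * move=> [v t]; apply: (@continuous_comp _ _ _
        (fun x : 'rV[R]_m.+1 * R => squeeze m (resize n.+1 x.1) (clock x.2)));
        last exact: resize_continuous.
      apply: (@continuous_comp _ _ _
        (fun x : 'rV[R]_m.+1 * R => (resize n.+1 x.1, x.2))
        (fun x : vec * R => squeeze m x.1 (clock x.2)));
        last exact: squeeze_clock_continuous.
      have c1 : {for (v, t), continuous (fun y : 'rV[R]_m.+1 * R => resize n.+1 y.1)}.
        apply: (@continuous_comp _ _ _ fst (@resize R m.+1 n.+1)); first exact: cvg_fst.
        exact: resize_continuous.
      have c2 : {for (v, t), continuous (fun y : 'rV[R]_m.+1 * R => y.2)} by exact: cvg_snd.
      exact: (cvg_pair c1 c2).
    * by move=> _ v t v0 _; apply: rs0 => //; exact: clock_itv.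
  + move=> q; rewrite [X in _ = X]/comp /Gr_to Gr_ofE clock0.
    have [v v0 ->] := linev_surj q.
    rewrite (@linev_rep_homogeneous _ _ _ (fun v => resize m.+1 (squeeze m (resize n.+1 v) 1))) //.
    rewrite (linev_rep_homogeneous _ v0); last exact: resizeZ.
    rewrite (@linev_rep_homogeneous _ _ _ (fun v => resize m.+1 (squeeze m v 1))) //.
    exact: (resize_neq0 (xn v) v0).
  + by move=> q; rewrite clock1 squeeze0 (resizeK (xn _)) repK.
Qed.

End homotopy.

Theorem theorem3p6 (R : realType) (n m : nat) (hn : (1 <= n)%N)
    (hm : (m <= n - 1)%N) :
  [/\ regular_CW_structure R (Gr_var R n m) (Gr_var_cells R n m),
      exists L : set (set (projectivization R n)),
        [/\ subcomplex L (Gr_var_cells R n m),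
            collapses (Gr_var_cells R n m) L
          & homeomorphic (set_type (realization L)) (RP R m)],
      homotopy_equivalent R (set_type (Gr_var R n m)) (RP R m)
    & simple_homotopy_equivalent R (Gr_var_cells R n m) (RP_cells R m)].
Proof.
case: n hn hm => // n _; rewrite subn1 => mn.
have rG := subcomplex_regular_CW (Gr_var_cells_subcomplex R n m).
have rRP := subcomplex_regular_CW (RP_cells_subcomplex R m).
have col := Gr_var_collapses R n m.
have [sL defL] := collapses_deformation col (Gr_var_cells_subcomplex R n m).
split.
- by split => //; exact: realization_Gr_var_cells.
- exists (@RP_sub_cells R n m); split => //.
  + exact: RP_sub_cells_subcomplex.
  + exact: RP_sub_homeomorphic.
- exact: Gr_var_homotopy_equivalent.
(* The formal deformation is the collapse followed by one cellular isomorphism. *)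
- split => //; apply: Relation_Operators.rst_trans defL _.
  apply: Relation_Operators.rst_step; apply: step_isomorphism => //.
  + exact: subcomplex_regular_CW.
  + exact: RP_sub_cellular_isomorphism.
Qed.
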